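(* For any dimension $d\ge 3$ there exists a constant $C=C(d)>0$ such that for every positive integer $N$, there is a point set $\mathcal{P}_N$ in $[0,1)^d$ with $N$ points such that $$\left\|D_{\mathcal{P}_N}\,\middle|\,\mathrm{BMO}^d\right\|\le C\,(\log N)^{(d-1)/2}.$$
   Context: Discrepancy function: for a positive integer $N$, a point set $\mathcal{P}_N\subset[0,1)^d$ with $N$ points and $x=(x_1,\ldots,x_d)\in[0,1)^d$, $$D_{\mathcal{P}_N}(x)=\sum_{z\in\mathcal{P}_N}\chi_{[0,x)}(z)-N x_1\cdots x_d,$$ where $[0,x)=[0,x_1)\times\cdots\times[0,x_d)$ and $\chi_A$ is the characteristic function of $A$. Dyadic intervals and Haar functions: for $j\in\mathbb{N}_0=\{0,1,2,\ldots\}$ let $\mathbb{D}_j=\{0,1,\ldots,2^j-1\}$, and for $m\in\mathbb{D}_j$ let $I_{j,m}=[2^{-j}m,2^{-j}(m+1))$. Let $h_{j,m}:[0,1)\to\mathbb{R}$ be supported in $I_{j,m}$, equal to $1$ on the left half $I_{j+1,2m}$ of $I_{j,m}$ and $-1$ on the right half $I_{j+1,2m+1}$. For $j=(j_1,\ldots,j_d)\in\mathbb{N}_0^d$ and $m=(m_1,\ldots,m_d)\in\mathbb{D}_j:=\mathbb{D}_{j_1}\times\cdots\times\mathbb{D}_{j_d}$ let $|j|=j_1+\cdots+j_d$, $I_{j,m}=I_{j_1,m_1}\times\cdots\times I_{j_d,m_d}$ and $h_{j,m}(x)=h_{j_1,m_1}(x_1)\cdots h_{j_d,m_d}(x_d)$.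 (Haar functions are normalized in $L_\infty$.) Dyadic product BMO (semi)norm: for an integrable function $f$ on $[0,1)^d$, $$\left\|f\,\middle|\,\mathrm{BMO}^d\right\|=\sup_{U\subset[0,1)^d}\left(|U|^{-1}\sum_{j\in\mathbb{N}_0^d}2^{|j|}\sum_{\substack{m\in\mathbb{D}_j\\ I_{j,m}\subset U}}|\langle f,h_{j,m}\rangle|^2\right)^{1/2},$$ where the supremum is taken over all measurable sets $U\subset[0,1)^d$, $|U|$ is the Lebesgue measure of $U$, and $\langle f,g\rangle=\int_{[0,1)^d}f g\,dx$.
   Formalization: The bound is stated for every integer N ≥ 2 rather than every positive integer N: for N = 1 the right-hand side is 0 while the BMO norm of the discrepancy function of any one-point set is strictly positive. *)

(* Defs.v *)
From HB Require Import structures.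
From mathcomp Require Import all_boot all_order all_algebra finmap.
From mathcomp Require Import all_classical all_reals all_analysis.

Set Implicit Arguments.
Unset Strict Implicit.
Unset Printing Implicit Defensive.
Import Order.TTheory GRing.Theory Num.Theory.
Import numFieldNormedType.Exports.

Local Open Scope classical_set_scope.
Local Open Scope ring_scope.

(* Points of R^d are d-tuples of reals. The library has no d-dimensional
   Lebesgue measure: its restriction to the Borel (product) sigma-algebra is
   built by iterating the product with the one-dimensional Lebesgue measure,
   then completed. *)

Lemma sigma_finite_product d1 d2 (T1 : measurableType d1)
    (T2 : measurableType d2) (R : realType)
    (m1 : {sigma_finite_measure set T1 -> \bar R})
    (m2 : {sigma_finite_measure set T2 -> \bar R}) :
  sigma_finite setT (m1 \x m2)%E.
Proof.
have /sigma_finiteP[F [TF ndF Foo]] := sigma_finiteT m1.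
have /sigma_finiteP[G [TG ndG Goo]] := sigma_finiteT m2.
exists (fun n => F n `*` G n).
  rewrite -setXTT TF TG predeqE => -[x y]; split.
    move=> [/= [n _ Fnx] [k _ Gky]]; exists (maxn n k) => //; split.
    - by move: x Fnx; exact/subsetPset/ndF/leq_maxl.
    - by move: y Gky; exact/subsetPset/ndG/leq_maxr.
  by move=> [n _ []/= ? ?]; split; exists n.
move=> k; have [? ?] := Foo k; have [? ?] := Goo k.
split; first exact: measurableX.
by rewrite product_measure1E// lte_mul_pinfty// ge0_fin_numE.
Qed.

Section tuple_cons.
Context {R : realType} {d : nat}.
Local Notation borelR := (measurableTypeR R).

Definition tuple_cons (p : borelR * d.-tuple borelR) : d.+1.-tuple borelR :=
  [tuple of p.1 :: p.2].

Definition tuple_uncons (t : d.+1.-tuple borelR) : borelR * d.-tuple borelR :=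
  (thead t, [tuple of behead t]).

Lemma tuple_consK : cancel tuple_cons tuple_uncons.
Proof.
move=> [x t]; rewrite /tuple_uncons /tuple_cons /=; congr (_, _).
exact: val_inj.
Qed.

Lemma measurable_tuple_cons : measurable_fun setT tuple_cons.
Proof. exact: measurable_cons. Qed.

Lemma measurable_tuple_uncons : measurable_fun setT tuple_uncons.
Proof.
apply/measurable_fun_pairP; split => /=.
  exact: (measurable_tnth ord0).
exact: measurable_behead.
Qed.

Variable mu : {sigma_finite_measure set (d.-tuple borelR) -> \bar R}.

Definition cons_measure : set (d.+1.-tuple borelR) -> \bar R :=
  pushforward (@lebesgue_measure R \x mu)%E tuple_cons.

Let cons_measure0 : cons_measure set0 = 0%E.
Proof. by rewrite /cons_measure /pushforward preimage_set0 measure0. Qed.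

Let cons_measure_ge0 A : (0 <= cons_measure A)%E.
Proof. by rewrite /cons_measure /pushforward measure_ge0. Qed.

Let cons_measure_sigma_additive : semi_sigma_additive cons_measure.
Proof.
apply: (measure_semi_sigma_additive (s := [the {measure set _ -> \bar R} of
  pushforward (@lebesgue_measure R \x mu)%E tuple_cons])).
exact: measurable_tuple_cons.
Qed.

HB.instance Definition _ := isMeasure.Build _ _ _ cons_measure
  cons_measure0 cons_measure_ge0 cons_measure_sigma_additive.

Let cons_measure_sigma_finite : sigma_finite setT cons_measure.
Proof.
have [F TF Foo] := sigma_finite_product (@lebesgue_measure R) mu.
exists (fun k => tuple_uncons @^-1` F k).
  by rewrite -preimage_bigcup -TF preimage_setT.
move=> k; have [mF Fk] := Foo k; split.
  by rewrite -[X in measurable X]setTI; exact: measurable_tuple_uncons.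
rewrite /cons_measure /pushforward -comp_preimage.
by rewrite (_ : _ \o _ = id) //; apply/funext => p; exact: tuple_consK.
Qed.

HB.instance Definition _ := Measure_isSigmaFinite.Build _ _ _ cons_measure
  cons_measure_sigma_finite.

End tuple_cons.

Fixpoint borel_lebesgue (R : realType) (d : nat) :
    {sigma_finite_measure set (d.-tuple (measurableTypeR R)) -> \bar R} :=
  match d with
  | 0 => dirac (nil_tuple _)
  | d'.+1 => cons_measure (borel_lebesgue R d')
  end.

Definition lebesgue_tuple (R : realType) (d : nat) :=
  @completed_measure_extension _ _ _ (borel_lebesgue R d).
Arguments lebesgue_tuple R d : clear implicits.

HB.instance Definition _ (R : realType) (d : nat) :=
  Measure.on (lebesgue_tuple R d).

Definition lebesgue_measurable (R : realType) (d : nat)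
    (U : set (d.-tuple R)) : Prop :=
  ((borel_lebesgue R d)^*%mu).-cara.-measurable U.

Section discrepancy.
Variables (R : realType) (d : nat).
Implicit Types (x z : d.-tuple R) (U : set (d.-tuple R)) (j m : d.-tuple nat).

Definition unit_cube : set (d.-tuple R) :=
  [set x | forall i, tnth x i \in `[0, 1[].

Definition anchored_box x : set (d.-tuple R) :=
  [set z | forall i, tnth z i \in `[0, tnth x i[].

(* The number N of points is read off P as its cardinality. *)
Definition discrepancy (P : {fset d.-tuple R}) x : R :=
  \sum_(z <- P) \1_(anchored_box x) z - #|` P|%:R * \prod_(i < d) tnth x i.

Definition dyadic_itv (j m : nat) : set R :=
  [set` `[m%:R / 2 ^+ j, m.+1%:R / 2 ^+ j[].

Definition haar1 (j m : nat) (t : R) : R :=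
  \1_(dyadic_itv j.+1 m.*2) t - \1_(dyadic_itv j.+1 m.*2.+1) t.

Definition dyadic_index j : set (d.-tuple nat) :=
  [set m | forall i, (tnth m i < 2 ^ tnth j i)%N].

Definition dyadic_box j m : set (d.-tuple R) :=
  [set x | forall i, dyadic_itv (tnth j i) (tnth m i) (tnth x i)].

Definition haar j m x : R :=
  \prod_(i < d) haar1 (tnth j i) (tnth m i) (tnth x i).

Definition inner (f g : d.-tuple R -> R) : R :=
  \int[lebesgue_tuple R d]_(x in unit_cube) (f x * g x).

Definition bmo_sum (f : d.-tuple R -> R) U : \bar R :=
  (\esum_(j in [set: d.-tuple nat])
     ((2 ^+ sumn j)%R%:E *
      \esum_(m in [set m | dyadic_index j m /\ (dyadic_box j m `<=` U)%classic])
        (`|inner f (haar j m)| ^+ 2)%R%:E))%E.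

(* A null set U contains no dyadic box, so its (0/0) term is void and only sets
   of positive measure are considered. The value is +oo if the supremum is
   infinite. *)
Definition bmo_norm (f : d.-tuple R -> R) : \bar R :=
  ereal_sup [set sqrte ((lebesgue_tuple R d U)^-1 * bmo_sum f U)%E | U in
    [set U | [/\ lebesgue_measurable U, (U `<=` unit_cube)%classic
               & (0 < lebesgue_tuple R d U)%E]]].

End discrepancy.

Arguments unit_cube {R d}.

(* Main.v *)
(** The points form an order 2 digital net in base [q = 2 ^ k].  A point is
    attached to every polynomial [f] of degree less than [n] over the field with
    [q] elements: coordinate [i] interlaces the Taylor coefficients of [f] at two
    of [2d] distinct elements.  Since [f] is determined by any [n] leading Taylor
    coefficients at these elements, functions of at most [n] such coefficients
    are averaged exactly.  For general [N] one takes [q ^ n.-1 < N <= q ^ n],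
    keeps the points whose first coordinate is below [N / q ^ n], and stretches
    that coordinate by [q ^ n / N].

    A Haar coefficient of the discrepancy is the quadrature error of a product of
    tent functions.  Each tent is a sum of mixed second differences with respect
    to the truncations of the two interlaced digit streams.  Terms of total depth
    at most [n] have no error, and a mixed difference vanishes where the tent is
    affine, so the remaining terms are supported near the three break points and
    are geometrically small.  Hence a box of size [2 ^ - |j|] above the scale
    [1 / N] has a coefficient of size [2 ^ - |j|] times a geometrically decaying
    factor, and these boxes contribute at most [(log N) ^ (d - 1) |U|].

    Below that scale a box contains a bounded number of points, and what matters
    is the sum of [2 ^ - |j|] over the boxes of level [j] around a point [p] that
    lie in [U].  Up to the factor [2 ^ d] this is the measure of the "twin" boxes
    obtained by choosing in every coordinate the half that does not contain [p].
    For fixed [p] the twins are pairwise disjoint, and a given [x] lies in a twin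
    only for the points that share with [x] one of the about [(log N) ^ (d - 1)]
    boxes of measure about [1 / N]. *)

Require Import Defs.
From mathcomp Require Import all_boot all_order all_algebra finmap.
From mathcomp Require Import all_classical all_reals all_analysis.
From mathcomp Require finfield.
From mathcomp Require Import measurable_realfun zify ring lra.
Import Order.TTheory GRing.Theory Num.Theory.
Import numFieldNormedType.Exports.
Set Implicit Arguments.
Unset Strict Implicit.
Unset Printing Implicit Defensive.
Local Open Scope ring_scope.

(** * Taylor coefficients and the interlaced net *)

Section taylor.
Variables (F : finFieldType) (S : finType) (alpha : S -> F).
Hypothesis alpha_inj : injective alpha.
Variable n : nat.
Implicit Types (f : {ffun 'I_n -> F}) (s : S).

Definition ffun_poly f : {poly F} := \poly_(i < n) (if insub i is Some j then f j else 0).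

Lemma ffun_polyB f g : ffun_poly (f - g) = ffun_poly f - ffun_poly g.
Proof.
apply/polyP=> i; rewrite coefB !coef_poly; case: ifP => [lt_in|_]; last by rewrite subr0.
by rewrite insubT !ffunE.
Qed.

Lemma ffun_poly_eq0 f : ffun_poly f = 0 -> f = 0.
Proof.
move=> f0; apply/ffunP=> i; have /polyP/(_ (i : nat)) := f0.
by rewrite coef_poly ltn_ord coef0 valK !ffunE.
Qed.

(** Coefficients of the shifted polynomial replace iterated derivatives, which would have to be
    divided by factorials that vanish in positive characteristic. *)
Definition taylor f s t : F := (ffun_poly f \Po ('X + (alpha s)%:P))`_t.

Lemma taylorB f g s t : taylor (f - g) s t = taylor f s t - taylor g s t.
Proof. by rewrite /taylor ffun_polyB comp_polyB coefB. Qed.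

Lemma size_shift_poly f s : (size (ffun_poly f \Po ('X + (alpha s)%:P)) <= n)%N.
Proof. by rewrite -[alpha s]opprK polyCN size_comp_poly2 ?size_XsubC ?size_poly. Qed.

Lemma taylor_small f s t : (n <= t)%N -> taylor f s t = 0.
Proof. by move=> le_nt; rewrite /taylor nth_default// (leq_trans (size_shift_poly f s)). Qed.

Lemma taylor_dvdp f s r : (forall t, (t < r)%N -> taylor f s t = 0) ->
  ('X - (alpha s)%:P) ^+ r %| ffun_poly f.
Proof.
move=> f0.
have dp : 'X^r %| (ffun_poly f \Po ('X + (alpha s)%:P)).
  rewrite -[X in _ %| X](poly_take_drop r) (_ : take_poly r _ = 0) ?add0r ?dvdp_mulIr//.
  by apply/polyP => i; rewrite coef_take_poly coef0; case: ifP => // /f0.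
have /(congr1 (comp_poly ('X - (alpha s)%:P))) := divpK dp.
rewrite -comp_polyA comp_polyD comp_polyX comp_polyC subrK comp_polyXr => <-.
by rewrite comp_polyM comp_Xn_poly dvdp_mulIr.
Qed.

(** Each run of zeros makes a power of ['X - alpha s] divide the polynomial. These powers are
    coprime for distinct [s], so their product, of degree at least [n], divides a polynomial of size
    at most [n]. *)
Lemma taylor_eq0 f (r : S -> nat) : (n <= \sum_s r s)%N ->
  (forall s t, (t < r s)%N -> taylor f s t = 0) -> f = 0.
Proof.
move=> le_nr f0; apply: ffun_poly_eq0; set p := ffun_poly f.
have dv (l : seq S) : uniq l -> \prod_(s <- l) ('X - (alpha s)%:P) ^+ r s %| p.
  elim: l => [_|s l IHl /= /andP[sl ul]]; first by rewrite big_nil dvd1p.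
  rewrite big_cons Gauss_dvdp; first by rewrite IHl// andbT taylor_dvdp// => t; exact: f0.
  rewrite -(big_map (fun s => ('X - (alpha s)%:P) ^+ r s) xpredT id).
  rewrite coprimep_sym; elim: l sl {IHl ul} => [_|u l IHl].
    by rewrite big_nil coprime1p.
  rewrite inE negb_or => /andP[su sl]; rewrite big_cons coprimepMl IHl// andbT.
  rewrite coprimep_expl// coprimep_expr// coprimep_XsubC root_XsubC.
  by rewrite (inj_eq alpha_inj).
apply/eqP; apply: contraTT (dv (index_enum S) (index_enum_uniq S)) => p0.
apply/negP => /dvdp_leq -/(_ p0); apply/negP; rewrite -ltnNge.
apply: leq_ltn_trans (size_poly _ _) _.
rewrite size_prod_seq; last by move=> s _; rewrite expf_neq0 ?polyXsubC_eq0.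
rewrite (eq_bigr (fun s => r s + 1)%N); last by move=> s _; rewrite size_exp_XsubC addn1.
by rewrite big_split /= sum1_size subSn ?leq_addl// addnK ltnS.
Qed.

Lemma taylor_inj f g (r : S -> nat) : (n <= \sum_s r s)%N ->
  (forall s t, (t < r s)%N -> taylor f s t = taylor g s t) -> f = g.
Proof.
move=> le_nr fg; apply/eqP; rewrite -subr_eq0; apply/eqP/(taylor_eq0 le_nr) => s t tr.
by rewrite taylorB fg// subrr.
Qed.

End taylor.

Lemma big_ord_double (V : nmodType) n (g : nat -> V) :
  \sum_(t < n.*2) g t = \sum_(t < n) g t.*2 + \sum_(t < n) g t.*2.+1.
Proof.
elim: n => [|n IHn]; first by rewrite !big_ord0 addr0.
rewrite doubleS !big_ord_recr/= IHn -!addrA; congr (_ + _).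
by rewrite addrCA.
Qed.

(** * Interlaced digits and exact averaging *)

Section net.
Variables (F : finFieldType) (d n : nat) (alpha : 'I_d * bool -> F).
Hypothesis alpha_inj : injective alpha.
Local Notation W := {ffun 'I_d -> {ffun 'I_(n.*2) -> F}}.
Implicit Types (f : {ffun 'I_n -> F}) (w : W) (e : 'I_d * bool -> nat).

(* Coordinate [i] interlaces the Taylor coefficients at the two points
   [alpha (i, false)] and [alpha (i, true)]. *)
Definition dig f : W :=
  [ffun i => [ffun tau : 'I_(n.*2) => taylor alpha f (i, odd tau) tau./2]].

(** Position [tau] holds entry [tau./2] of the stream [(i, odd tau)]. Cut entries become 0 instead
    of being dropped, so that truncation is an additive idempotent of one fixed type. *)
Definition trunc e w : W :=
  [ffun i => [ffun tau : 'I_(n.*2) => if (tau./2 < e (i, odd tau))%N then w i tau else 0]].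

Lemma truncE e w i (tau : 'I_(n.*2)) :
  trunc e w i tau = if (tau./2 < e (i, odd tau))%N then w i tau else 0.
Proof. by rewrite !ffunE. Qed.

Lemma trunc_idem e e' w : (forall s, e s <= e' s)%N ->
  trunc e (trunc e' w) = trunc e w.
Proof.
move=> ee; apply/ffunP=> i; apply/ffunP=> t; rewrite !ffunE.
by case: ifP => // te; rewrite (leq_trans te).
Qed.

Lemma truncB e w w' : trunc e (w - w') = trunc e w - trunc e w'.
Proof.
apply/ffunP=> i; apply/ffunP=> t; rewrite !ffunE.
by case: ifP => // te; rewrite ?ffunE ?subr0.
Qed.

Lemma card_depth e i : (forall s, e s <= n)%N ->
  #|[pred tau : 'I_(n.*2) | (tau./2 < e (i, odd tau))%N]| = (e (i, false) + e (i, true))%N.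
Proof.
move=> en; rewrite -sum1_card big_mkcond/=.
rewrite (big_ord_double _ (fun tau => if (tau./2 < e (i, odd tau))%N then 1%N else 0%N)).
have cnt b : \sum_(t < n) (if (t < e (i, b))%N then 1%N else 0%N) = e (i, b).
  rewrite -[RHS](minn_idPr (en (i, b))); elim: {en}n => [|m IHm]; first by rewrite big_ord0 min0n.
  by rewrite big_ord_recr/= IHm; case: ifP; lia.
congr (_ + _)%N; rewrite -[RHS]cnt; apply: eq_bigr => t _.
  by rewrite odd_double doubleK.
by rewrite /= odd_double/= uphalf_double.
Qed.

Lemma card_trunc_fixed e : (forall s, e s <= n)%N ->
  #|[set w | trunc e w == w]| = (#|F| ^ \sum_s e s)%N.
Proof.
move=> en.
rewrite (@eq_card _ _ (family (fun i => pffun_on 0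
  [pred tau : 'I_(n.*2) | (tau./2 < e (i, odd tau))%N] (@predT F)))); last first.
  move=> w; rewrite inE; apply/eqP/familyP => [<- i|we].
    apply/pffun_onP; split => //; apply/supportP => t; rewrite inE !ffunE => /negbTE.
    by move->.
  apply/ffunP => i; apply/ffunP=> t; rewrite !ffunE; case: ifPn => // te.
  by have /pffun_onP[/supportP/(_ t) -> //] := we i.
rewrite card_family /image_mem.
rewrite (eq_map (g := fun i => (#|F| ^ (e (i, false) + e (i, true)))%N)); last first.
  by move=> i; rewrite card_pffun_on card_depth.
rewrite foldrE big_map big_enum/= -expn_sum; congr (_ ^ _)%N.
rewrite (eq_bigr (fun i => \sum_b e (i, b))%N); last first.
  by move=> i _; rewrite big_bool addnC.
by rewrite pair_big; apply: eq_bigr => -[].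
Qed.

Lemma dig_inj e f g : (n <= \sum_s e s)%N -> trunc e (dig f) = trunc e (dig g) -> f = g.
Proof.
move=> ne fg; apply: (taylor_inj alpha_inj ne) => -[i b] t te.
have [nt|tn] := leqP n t; first by rewrite !taylor_small.
have tn2 : (b + t.*2 < n.*2)%N by case: b {te} => /=; lia.
have /ffunP/(_ i)/ffunP/(_ (Ordinal tn2)) := fg; rewrite !ffunE/=.
by rewrite oddD odd_double addbF oddb halfD odd_double andbF doubleK add0n (_ : b./2 = 0%N) ?te//; case: b {te tn2}.
Qed.

(** Truncation is additive, so its nonempty fibres are translates of its kernel. *)
Lemma trunc_fiber e (w : W) : trunc e w = w ->
  #|[set v | trunc e v == w]| = #|[set v | trunc e v == 0]|.
Proof.
move=> ew; rewrite -(card_imset _ (addIr (- w))); apply: eq_card => v.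
rewrite [RHS]inE; apply/imsetP/eqP => [[u /[!inE]/eqP eu ->]|v0].
  by rewrite truncB eu ew subrr.
exists (v + w); last by rewrite addrK.
by rewrite inE -subr_eq0 -{2}ew -truncB addrK v0.
Qed.

(* A family of depths of total at most [n] extends to one of total exactly [n],
   and then truncation makes [dig] a bijection onto the truncated arrays. *)
Lemma sum_dig_depth (R : comPzRingType) e (G : W -> R) :
  (0 < d)%N -> (\sum_s e s <= n)%N -> (forall w, G w = G (trunc e w)) ->
  #|{: W}|%:R * \sum_f G (dig f) = (#|F| ^ n)%:R * \sum_w G w.
Proof.
move=> d_gt0 le_en Ge; pose i0 := (Ordinal d_gt0, false).
have [m def_n] : exists m, (n = \sum_s e s + m)%N by exists (n - \sum_s e s)%N; rewrite subnKC.
(* The whole missing depth [m] is put on the single stream [i0]. *)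
pose e' s := (e s + m * (s == i0))%N.
have sum_e' : (\sum_s e' s = n)%N.
  rewrite big_split def_n/=; congr (_ + _)%N.
  rewrite (bigD1 i0)//= muln1 big1 ?addn0// => s.
  by move=> /negbTE->; rewrite muln0.
have le_e'n s : (e' s <= n)%N by rewrite -sum_e' (bigD1 s)//= leq_addr.
have Ge' w : G w = G (trunc e' w).
  by rewrite Ge [RHS]Ge trunc_idem// => s; rewrite leq_addr.
pose A := [set w : W | trunc e' w == w].
have cA : #|A| = (#|F| ^ n)%N by rewrite card_trunc_fixed// sum_e'.
have inA w : trunc e' w \in A by rewrite inE trunc_idem.
have inj : injective (fun f => trunc e' (dig f)).
  by move=> f g; apply: dig_inj; rewrite sum_e'.
have imA : [set trunc e' (dig f) | f in [set: {ffun 'I_n -> F}]] = A.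
  apply/eqP; rewrite eqEcard; apply/andP; split.
    by apply/fintype.subsetP => _ /imsetP[f _ ->].
  by rewrite cA card_imset// cardsT card_ffun card_ord.
have sumf : \sum_f G (dig f) = \sum_(w in A) G w.
  rewrite -imA big_imset/=; last by move=> ? ? _ _; exact: inj.
  by apply: eq_big => [f|f _]; rewrite ?inE -?Ge'.
pose c := #|[set v : W | trunc e' v == 0]|.
(* All fibres have the same size [c]; its value is found in [cW] by taking the constant function
   1. *)
have part (H : W -> R) : (forall w, H w = H (trunc e' w)) ->
    \sum_w H w = c%:R * \sum_(w in A) H w.
  move=> He; rewrite (partition_big (trunc e') (mem A)); last by move=> w _; exact: inA.
  rewrite big_distrr/=; apply: eq_bigr => w; rewrite inE => /eqP ew.
  rewrite (eq_bigr (fun=> H w)); last by move=> v /eqP wv; rewrite He wv.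
  rewrite sumr_const [RHS]mulr_natl; congr (_ *+ _).
  by rewrite /c -(trunc_fiber ew); apply: eq_card => v; rewrite inE.
have cW : #|{: W}|%:R = c%:R * (#|F| ^ n)%:R :> R.
  have := part (fun=> 1) (fun=> erefl); rewrite !sumr_const -cA => <-.
  by congr (_%:R); apply: eq_card.
by rewrite sumf cW (part _ Ge') mulrCA mulrA.
Qed.

End net.

(** * Tent functions and digit truncation *)

Section tent.
Variable R : realFieldType.
Implicit Types A B x y : R.

(** The primitive of the Haar function of [[A, B[] that vanishes outside this interval. *)
Definition tent A B x : R := Num.max 0 (Num.min (x - A) (B - x)).

Variant tent_spec A B x : R -> Prop :=
  | TentLow of x <= A : tent_spec A B x 0
  | TentHigh of B <= x : tent_spec A B x 0
  | TentUp of A <= x & x - A <= B - x : tent_spec A B x (x - A)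
  | TentDown of x <= B & B - x <= x - A : tent_spec A B x (B - x).

Lemma tentP A B x : tent_spec A B x (tent A B x).
Proof.
rewrite /tent; case: (leP (x - A) (B - x)) => h; case: leP => h0.
- by apply: TentUp; lra.
- by apply: TentLow; lra.
- by apply: TentDown; lra.
- by apply: TentHigh; lra.
Qed.

Lemma tent_ge0 A B x : 0 <= tent A B x.
Proof. by case: tentP; lra. Qed.

Lemma tent_le A B x : A <= B -> tent A B x <= (B - A) / 2.
Proof. by move=> AB; case: tentP; lra. Qed.

Lemma tent_gt0 A B x : tent A B x != 0 -> A < x < B.
Proof.
apply: contraNT; rewrite negb_and -!leNgt => /orP nx; apply/eqP.
by case: tentP; case: nx; lra.
Qed.

Lemma tent_lip A B x y : `|tent A B x - tent A B y| <= `|x - y|.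
Proof.
by case: (tentP A B x) => *; case: (tentP A B y) => *; rewrite ler_norml;
  case: (ger0P (x - y)) => *; apply/andP; split; lra.
Qed.

Lemma tentZ A B x (t : R) : 0 < t -> tent A B (t * x) = t * tent (A / t) (B / t) x.
Proof.
move=> t0; have tA (C : R) : t * (C / t) = C by rewrite mulrC divfK ?gt_eqF.
by rewrite /tent maxr_pMr ?ltW// minr_pMr ?ltW// !mulrBr !tA mulr0.
Qed.

(* The break points [A], [(A + B) / 2] and [B] of the tent. *)
Definition brk A B (k : 'I_3) : R := A + k%:R * ((B - A) / 2).

Lemma tent_affine A B y l : A <= B -> (forall k, ~~ (y <= brk A B k < y + l)) ->
  exists s c, forall x, y <= x < y + l -> tent A B x = s * x + c.
Proof.
move=> AB nk.
have := nk ord_max; have := nk (@Ordinal 3 1 isT); have := nk ord0; rewrite /brk/= {nk}.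
rewrite mul0r addr0 mul1r (_ : A + 2%:R * ((B - A) / 2) = B); last by lra.
rewrite !negb_and -!ltNge -!leNgt => /orP hA /orP hK /orP hB.
have [By|yB] := ltrP B y.
  by exists 0, 0 => x /andP[yx _]; case: tentP; lra.
have {}hB : y + l <= B by case: hB; lra.
case: hA => hA; last by exists 0, 0 => x /andP[yx xy]; case: tentP; lra.
case: hK => hK; first by exists (- 1), B => x /andP[yx xy]; case: tentP; lra.
by exists 1, (- A) => x /andP[yx xy]; case: tentP; lra.
Qed.

(** A window at least as long as [[A, B]] cannot fit strictly between the outer break points, so if
    it contains neither of them it lies on one side of the support. *)
Lemma tent_support A B y l : B - A <= l -> (forall k, ~~ (y <= brk A B k < y + l)) ->
  forall x, y <= x < y + l -> tent A B x = 0.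
Proof.
move=> BAl nk x /andP[yx xy].
have := nk ord_max; have := nk ord0; rewrite /brk/= {nk}.
rewrite mul0r addr0 (_ : A + 2%:R * ((B - A) / 2) = B); last by lra.
rewrite !negb_and -!ltNge -!leNgt => /orP hA /orP hB.
by case: tentP; case: hA; case: hB; lra.
Qed.

End tent.

Lemma sum_mixed_diff (V : comPzRingType) (H : nat -> nat -> V) m l :
  \sum_(a < m) \sum_(b < l) (H a.+1 b.+1 - H a b.+1 - H a.+1 b + H a b) =
  H m l - H 0%N l - H m 0%N + H 0%N 0%N.
Proof.
have in_b a : \sum_(b < l) (H a.+1 b.+1 - H a b.+1 - H a.+1 b + H a b) =
    H a.+1 l - H a l - H a.+1 0%N + H a 0%N.
  elim: l => [|l IHl]; first by rewrite big_ord0; ring.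
  by rewrite big_ord_recr/= IHl; ring.
elim: m => [|m IHm]; first by rewrite big_ord0; ring.
by rewrite big_ord_recr/= in_b IHm; ring.
Qed.

(** * Digit prefixes in base [q] and the two digit streams *)

Section prefix.
Variable q : nat.
Implicit Types c : nat -> nat.

Fixpoint prefix c t : nat := if t is u.+1 then (prefix c u * q + c u)%N else 0%N.

Lemma prefix_bounds c s t : (forall u, c u < q)%N ->
  (prefix c s * q ^ t <= prefix c (s + t) < (prefix c s).+1 * q ^ t)%N.
Proof.
move=> cq; elim: t => [|t /andP[IH1 IH2]]; first by rewrite addn0 !expn0 !muln1 leqnn ltnSn.
rewrite addnS/= expnSr; have := cq (s + t)%N; set P := prefix c (s + t) in IH1 IH2 *.
have lt_leq (a b : nat) : (a < b)%N -> (a * q + q <= b * q)%N.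
  by move=> ab; rewrite -mulSnr leq_mul2r ab orbT.
move=> cs; rewrite !mulnA; apply/andP; split.
  by rewrite (leq_trans _ (leq_addr _ _))// leq_mul2r IH1 orbT.
by apply: leq_trans (lt_leq _ _ IH2); rewrite ltn_add2l.
Qed.

Lemma prefix_lt c t : (forall u, c u < q)%N -> (prefix c t < q ^ t)%N.
Proof. by move=> cq; have /andP[_] := prefix_bounds 0 t cq; rewrite mul1n. Qed.

Lemma prefix_inj c c' s : (forall u, c u < q)%N -> (forall u, c' u < q)%N ->
  prefix c s = prefix c' s -> forall t, (t < s)%N -> c t = c' t.
Proof.
move=> cq cq'; elim: s => [|s IHs] //= E t; rewrite ltnS leq_eqVlt.
have E1 : c s = c' s.
  by have := congr1 (modn^~ q) E; rewrite !modnMDl !modn_small.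
have q0 : (0 < q)%N by rewrite (leq_ltn_trans _ (cq 0%N)).
case/orP => [/eqP->//|]; apply: IHs.
by have := congr1 (divn^~ q) E; rewrite !divnMDl// !divn_small// !addn0.
Qed.

Lemma eq_prefix c c' s : (forall t, (t < s)%N -> c t = c' t) -> prefix c s = prefix c' s.
Proof.
elim: s => //= s IHs E; rewrite E// IHs// => t ts; apply: E; exact: ltnW.
Qed.

Variable R : realFieldType.
Hypothesis q_gt0 : (0 < q)%N.
Local Notation Q := (q%:R : R).

Let Q_gt0 : 0 < Q. Proof. by rewrite ltr0n. Qed.
Let QX_gt0 t : 0 < Q ^+ t. Proof. by rewrite exprn_gt0. Qed.

(** Digits are split by the parity of their position so that the two streams can be cut at
    independent depths. *)
Definition even_part c a : R := \sum_(t < a) (c t.*2)%:R / Q ^+ t.*2.+1.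
Definition odd_part c b : R := \sum_(t < b) (c t.*2.+1)%:R / Q ^+ t.*2.+2.

Lemma even_odd_prefix c b : even_part c b + odd_part c b = (prefix c b.*2)%:R / Q ^+ b.*2.
Proof.
elim: b => [|b IHb]; first by rewrite /even_part /odd_part !big_ord0 mul0r addr0.
rewrite /even_part /odd_part !big_ord_recr/= -/(even_part c b) -/(odd_part c b).
rewrite addrACA IHb doubleS/= !natrD !natrM !natrD !natrM !exprS.
have := lt0r_neq0 Q_gt0; have := lt0r_neq0 (QX_gt0 b.*2).
by move=> ? ?; field; apply/andP; split.
Qed.

Definition in_block c t (v : R) : bool :=
  (prefix c t)%:R <= v * Q ^+ t < (prefix c t).+1%:R.

Lemma in_blockE c t v : in_block c t v =
  ((prefix c t)%:R / Q ^+ t <= v < (prefix c t)%:R / Q ^+ t + (Q ^+ t)^-1).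
Proof.
rewrite /in_block ler_pdivrMr//; congr (_ && _).
by rewrite -[X in _ = (_ < _ + X)]mul1r -mulrDl -natr1 ltr_pdivlMr.
Qed.

Lemma in_block_uniq c c' t v : in_block c t v -> in_block c' t v ->
  prefix c t = prefix c' t.
Proof.
move=> /andP[h1 h2] /andP[h3 h4].
have := le_lt_trans h1 h4; have := le_lt_trans h3 h2; rewrite !ltr_nat !ltnS => ? ?.
by apply/eqP; rewrite eqn_leq; apply/andP.
Qed.

Hypothesis (c : nat -> nat) (c_lt : forall u, (c u < q)%N).

Lemma even_part_homo : {homo even_part c : a b / (a <= b)%N >-> a <= b}.
Proof.
apply: homo_leq => // [x y z|a]; first exact: le_trans.
by rewrite /even_part big_ord_recr/= lerDl divr_ge0// ltW.
Qed.

Lemma odd_part_homo : {homo odd_part c : a b / (a <= b)%N >-> a <= b}.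
Proof.
apply: homo_leq => // [x y z|a]; first exact: le_trans.
by rewrite /odd_part big_ord_recr/= lerDl divr_ge0// ltW.
Qed.

(** Digits from position [t.*2] on cannot change the first [t.*2] digits, whichever stream they
    belong to. *)
Lemma in_block_parts t a b : (t <= a)%N -> (t <= b)%N ->
  in_block c t.*2 (even_part c a + odd_part c b).
Proof.
move=> ta tb; rewrite in_blockE -even_odd_prefix.
rewrite lerD ?even_part_homo ?odd_part_homo//=.
(* Extending both streams to the common depth [m] only increases the sum, and at equal depths the
   sum is an ordinary prefix. *)
set m := maxn a b.
have tm : (t <= m)%N by rewrite leq_max ta.
apply: (@le_lt_trans _ _ (even_part c m + odd_part c m)).
  by rewrite lerD ?even_part_homo ?odd_part_homo// ?leq_maxl ?leq_maxr.
rewrite !even_odd_prefix -[X in _ < _ + X]mul1r -mulrDl natr1.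
rewrite ltr_pdivrMr// mulrAC ltr_pdivlMr// -!natrX -!natrM ltr_nat.
have /andP[_] := prefix_bounds t.*2 (m.*2 - t.*2) c_lt.
rewrite subnKC ?leq_double// => lt_p.
rewrite -(ltn_pmul2r (_ : 0 < q ^ t.*2)%N) ?expn_gt0 ?q_gt0// in lt_p.
by rewrite -mulnA -expnD subnK ?leq_double// in lt_p.
Qed.

Lemma even_part_step a : `|even_part c a.+1 - even_part c a| <= Q ^+ 2 / Q ^+ a.+1.*2.
Proof.
rewrite /even_part big_ord_recr/= addrAC subrr add0r ger0_norm ?divr_ge0 ?(ltW (QX_gt0 _))//.
rewrite ler_pdivrMr// mulrAC ler_pdivlMr// -exprD -natrX -[_ ^+ (2 + _)]natrX -natrM ler_nat.
rewrite (_ : 2 + a.*2.+1 = a.+1.*2 + 1)%N; last by lia.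
by rewrite expnD mulnC leq_mul2l expn1 ltnW ?orbT.
Qed.

Lemma odd_part_step b : `|odd_part c b.+1 - odd_part c b| <= Q ^+ 2 / Q ^+ b.+1.*2.
Proof.
rewrite /odd_part big_ord_recr/= addrAC subrr add0r ger0_norm ?divr_ge0 ?(ltW (QX_gt0 _))//.
rewrite doubleS ler_pM2r ?invr_gt0// -natrX ler_nat.
by rewrite (leq_trans (ltnW (c_lt _)))// expnS leq_pmulr ?expn_gt0 ?q_gt0.
Qed.

End prefix.

(** * Mixed differences of a tent along the two streams *)

Section mixed.
Variables (R : realFieldType) (q : nat).
Hypothesis q_gt0 : (0 < q)%N.
Local Notation Q := (q%:R : R).
Variables (A B : R) (a0 : nat) (c : nat -> nat).
Hypotheses (AB : A <= B) (BA_le : B - A <= (Q ^+ a0.*2)^-1).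
Hypothesis c_lt : forall u, (c u < q)%N.

Let Q_gt0 : 0 < Q. Proof. by rewrite ltr0n. Qed.
Let QX_gt0 t : 0 < Q ^+ t. Proof. by rewrite exprn_gt0. Qed.

(* [corner a b] is the tent at the point whose even and odd digit streams are
   cut at depths [a0 + a.-1] and [a0 + b.-1]; the zero row and column make the
   sum of all mixed differences telescope. *)
Definition corner a b : R :=
  match a, b with
  | a'.+1, b'.+1 => tent A B (even_part q R c (a0 + a') + odd_part q R c (a0 + b'))
  | _, _ => 0
  end.

Definition mixed a b : R :=
  corner a.+1 b.+1 - corner a b.+1 - corner a.+1 b + corner a b.

Lemma corner_even a b : (0 < a)%N ->
  `|corner a.+1 b - corner a b| <= Q ^+ 2 / Q ^+ (a0 + a).*2.
Proof.
case: a b => [|a] [|b] //= _.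
  by rewrite subrr normr0 divr_ge0// ltW.
apply: le_trans (tent_lip _ _ _ _) _; rewrite opprD addrACA subrr addr0.
by rewrite !addnS even_part_step.
Qed.

Lemma corner_odd a b : (0 < b)%N ->
  `|corner a b.+1 - corner a b| <= Q ^+ 2 / Q ^+ (a0 + b).*2.
Proof.
case: a b => [|a] [|b] //= _.
  by rewrite subrr normr0 divr_ge0// ltW.
apply: le_trans (tent_lip _ _ _ _) _; rewrite opprD addrACA subrr add0r.
by rewrite !addnS odd_part_step.
Qed.

(** A mixed difference is the difference of two steps in the deeper direction, each small because
    the tent is 1-Lipschitz. For [a = b = 0] it is the tent itself, bounded by its height. *)
Lemma mixed_bound a b :
  `|mixed a b| <= 2 * Q ^+ 2 / Q ^+ (a0 + maxn a b).*2.
Proof.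
have twice (x y z : R) : `|x| <= z -> `|y| <= z -> `|x - y| <= 2 * z.
  by move=> hx hy; apply: le_trans (ler_normB _ _) _; lra.
rewrite -mulrA.
have [] := leqP b a; last first.
  move=> ab; have b0 : (0 < b)%N by rewrite (leq_ltn_trans _ ab).
  rewrite (_ : mixed a b = (corner a.+1 b.+1 - corner a.+1 b) - (corner a b.+1 - corner a b)).
    by apply: twice; exact: corner_odd.
  by rewrite /mixed; ring.
case: a => [|a] ba.
  move: ba; rewrite leqn0 => /eqP ->; rewrite /mixed/= !subr0 !addr0 !addn0.
  rewrite ger0_norm ?tent_ge0//; apply: le_trans (tent_le _ AB) _.
  have q1 : 1 <= Q ^+ 2 by rewrite exprn_ege1// ler1n.
  apply: (@le_trans _ _ (Q ^+ a0.*2)^-1).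
    have : 0 <= B - A by rewrite subr_ge0.
    by move: BA_le; lra.
  have p0 : 0 < (Q ^+ a0.*2)^-1 by rewrite invr_gt0.
  rewrite mulrA ler_peMl ?ltW//; lra.
rewrite (_ : mixed _ _ = (corner a.+2 b.+1 - corner a.+1 b.+1) - (corner a.+2 b - corner a.+1 b)).
  by apply: twice; exact: corner_even.
by rewrite /mixed; ring.
Qed.

(** The corners involved share the first [2t] digits with [t = a0 + (minn a b).-1], since
    [corner a b] is cut at [a0 + a.-1] and [a0 + b.-1]. Without a break point in that block the tent
    is affine there and the mixed difference cancels. If [minn a b = 0], some corners are 0 by
    convention and affinity does not suffice, but then the block is as long as the support and the
    tent vanishes on it. *)
Lemma mixed_support a b : mixed a b != 0 ->
  [exists k, in_block q c (a0 + (minn a b).-1).*2 (brk A B k)].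
Proof.
set t := (a0 + _)%N; apply: contraNT; rewrite negb_exists => /forallP nk; apply/eqP.
have {}nk k : ~~ ((prefix q c t.*2)%:R / Q ^+ t.*2 <= brk A B k <
    (prefix q c t.*2)%:R / Q ^+ t.*2 + (Q ^+ t.*2)^-1).
  by rewrite -in_blockE//; exact: nk.
have inb a' b' : (t <= a0 + a')%N -> (t <= a0 + b')%N ->
   (prefix q c t.*2)%:R / Q ^+ t.*2 <= even_part q R c (a0 + a') + odd_part q R c (a0 + b') <
    (prefix q c t.*2)%:R / Q ^+ t.*2 + (Q ^+ t.*2)^-1.
  by move=> *; rewrite -in_blockE//; exact: in_block_parts.
have [ab0|ab0] := posnP (minn a b).
  have t0 : t = a0 by rewrite /t ab0 addn0.
  have corner0 a' b' : corner a' b' = 0.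
    case: a' b' => [|a'] [|b'] //=; apply: (tent_support _ nk); first by rewrite t0.
    by apply: inb; rewrite t0 leq_addr.
  by rewrite /mixed !corner0; ring.
have [s [c0 aff]] := tent_affine AB nk.
move: ab0; rewrite leq_min => /andP[a_gt0 b_gt0].
have affE a' b' : (a <= a')%N -> (b <= b')%N -> corner a' b' =
    s * (even_part q R c (a0 + a'.-1) + odd_part q R c (a0 + b'.-1)) + c0.
  case: a' b' => [|a'] [|b'] //= ha hb; try by lia.
  by apply: aff; apply: inb; rewrite /t; lia.
by rewrite /mixed !affE//=; ring.
Qed.

Lemma sum_mixed n :
  \sum_(a < n.+1) \sum_(b < n.+1) mixed a b =
  tent A B (even_part q R c (a0 + n) + odd_part q R c (a0 + n)).
Proof. by rewrite sum_mixed_diff/=; ring. Qed.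

End mixed.

(** * Riemann sums of tents *)

Section riemann.
Variables (R : realFieldType) (M : nat).
Hypothesis M_gt0 : (0 < M)%N.
Implicit Types A B : R.

(* [tent A B] is a second difference of ramps, and the Riemann sums of [ramp A]
   are compared with the telescoping sum of its primitive [ramp A x ^+ 2 / 2]. *)
Let ramp A (x : R) : R := Num.max 0 (x - A).

Let sum_ramp A : 0 <= A <= 1 ->
  `|(\sum_(X < M) ramp A (X%:R / M%:R)) / M%:R - (1 - A) ^+ 2 / 2| <= M%:R^-1.
Proof.
move=> /andP[A0 A1]; pose H (x : R) := ramp A x ^+ 2 / 2.
pose e : R := M%:R^-1; have e_gt0 : 0 < e by rewrite invr_gt0 ltr0n.
(* [H] is a primitive of the 1-Lipschitz function [ramp A], so a step of length [e] costs at most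
   [e ^+ 2]. *)
have step x : 0 <= H (x + e) - H x - e * ramp A x <= e ^+ 2.
  rewrite /H /ramp; have e2 : 0 <= e ^+ 2 by rewrite sqr_ge0.
    case: (leP 0 (x + e - A)) => h1; case: (leP 0 (x - A)) => h2; [|  |exfalso; lra|].
    - rewrite (_ : _ - _ = e ^+ 2 / 2); last by field.
      by apply/andP; split; lra.
    - rewrite expr0n/= mul0r mulr0 !subr0; have : (x + e - A) ^+ 2 <= e ^+ 2.
        by rewrite ler_sqr ?nnegrE; lra.
      by have := sqr_ge0 (x + e - A); move=> ? ?; apply/andP; split; lra.
    - by rewrite expr0n/= mul0r mulr0 !subr0 lexx.
have -> : (1 - A) ^+ 2 / 2 = \sum_(X < M) (H (X%:R * e + e) - H (X%:R * e)).
  rewrite (eq_bigr (fun X : 'I_M => H (X.+1%:R * e) - H (X%:R * e))); last first.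
    by move=> X _; rewrite -natr1 mulrDl mul1r.
  rewrite -(big_mkord xpredT (fun X => H (X.+1%:R * e) - H (X%:R * e))) telescope_sumr//.
  rewrite mul0r divff ?pnatr_eq0 -?lt0n// /H /ramp.
  have r1 : Num.max 0 (1 - A) = 1 - A by rewrite max_r// subr_ge0.
  have r0 : Num.max 0 (0 - A) = 0 by rewrite max_l// sub0r oppr_le0.
  by rewrite r1 r0 expr0n/= mul0r subr0.
rewrite distrC mulr_suml -sumrB; apply: le_trans (ler_norm_sum _ _ _) _.
rewrite -[M%:R^-1]/e [leRHS](_ : e = \sum_(X < M) e ^+ 2); last first.
  rewrite sumr_const card_ord -[RHS]mulr_natl exprS expr1 mulrA divff ?mul1r//.
  by rewrite pnatr_eq0 -lt0n.
apply: ler_sum => X _; have /andP[] := step (X%:R * e).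
by move=> h1 h2; rewrite [ramp _ _ * e]mulrC ger0_norm.
Qed.

(** The constant 4 is [1 + 2 + 1]: the ramp at the midpoint counts twice. *)
Lemma sum_tent A B : 0 <= A -> A <= B -> B <= 1 ->
  `|(\sum_(X < M) tent A B (X%:R / M%:R)) / M%:R - (B - A) ^+ 2 / 4| <= 4 / M%:R.
Proof.
move=> A0 AB B1; pose K := (A + B) / 2.
have tentE x : tent A B x = ramp A x - 2 * ramp K x + ramp B x.
  by rewrite /ramp /K; case: tentP => *; do 3 case: leP => *; lra.
have sA : 0 <= A <= 1 by lra.
have sB : 0 <= B <= 1 by lra.
have sK : 0 <= K <= 1 by rewrite /K; lra.
under eq_bigr do rewrite tentE.
rewrite big_split sumrB/= -mulr_sumr.
have := sum_ramp sA; have := sum_ramp sB; have := sum_ramp sK.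
rewrite !ler_norml.
set a := \sum_(_ < _) _; set b := \sum_(_ < _) _; set k := \sum_(_ < _) _; set e := _^-1.
rewrite /K => /andP[h1 h2] /andP[h3 h4] /andP[h5 h6]; apply/andP; split; lra.
Qed.

End riemann.

(** * Quadrature error of the net *)

Section coordinates.
Variables (R : realFieldType) (F : finFieldType) (n : nat).
Local Notation q := #|F|.
Local Notation Q := (q%:R : R).
Implicit Types u : {ffun 'I_(n.*2) -> F}.

Lemma q_gt0 : (0 < q)%N.
Proof. by apply/card_gt0P; exists 0. Qed.

(** Digits from position [n.*2] on are 0, which lets the streams be cut at any depth. *)
Definition digit u tau : nat := if insub tau is Some t then enum_rank (u t) else 0.

Lemma digit_lt u tau : (digit u tau < q)%N.
Proof. by rewrite /digit; case: insubP => [t _ _|_]; rewrite ?ltn_ord ?q_gt0. Qed.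

Lemma digit_large u tau : (n.*2 <= tau)%N -> digit u tau = 0%N.
Proof. by move=> h; rewrite /digit insubN// -leqNgt. Qed.

Lemma digit_inj u u' (tau : 'I_(n.*2)) : digit u tau = digit u' tau -> u tau = u' tau.
Proof. by rewrite /digit !valK => /val_inj/enum_rank_inj. Qed.

Lemma eq_digit u u' (tau : 'I_(n.*2)) : u tau = u' tau -> digit u tau = digit u' tau.
Proof. by rewrite /digit !valK => ->. Qed.

Definition net_coord u : R := even_part q R (digit u) n + odd_part q R (digit u) n.

Lemma even_part_large u m : even_part q R (digit u) (n + m) = even_part q R (digit u) n.
Proof.
rewrite /even_part big_split_ord/= [X in _ + X]big1 ?addr0// => t _.
by rewrite digit_large ?mul0r// leq_double leq_addr.
Qed.

Lemma odd_part_large u m : odd_part q R (digit u) (n + m) = odd_part q R (digit u) n.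
Proof.
rewrite /odd_part big_split_ord/= [X in _ + X]big1 ?addr0// => t _.
by rewrite digit_large ?mul0r// ltnW// ltnS leq_double leq_addr.
Qed.

(** A block fixes the first [t.*2] digits, so its members inject into the choices of the remaining
    ones. *)
Lemma card_block t (v : R) : (t <= n)%N ->
  #|[set u | in_block q (digit u) t.*2 v]|%:R <= Q ^+ n.*2 / Q ^+ t.*2.
Proof.
move=> tn; set A := [set u | _].
rewrite ler_pdivlMr ?exprn_gt0 ?ltr0n ?q_gt0// -!natrX -natrM ler_nat.
have le_tn2 : (t.*2 <= n.*2)%N by rewrite leq_double.
rewrite -[X in (_ <= _ ^ X)%N](subnK le_tn2) expnD leq_mul2r; apply/orP; right.
pose ext u tau : F := if insub tau is Some t then u t else 0.
pose g u : {ffun 'I_(n.*2 - t.*2) -> F} := [ffun s : 'I__ => ext u (t.*2 + s)%N].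
rewrite -[X in (_ <= _ ^ X)%N](card_ord (n.*2 - t.*2)) -card_ffun.
apply: (@leq_card_in _ _ g) => u u'; rewrite !inE => hu hu' /ffunP eg.
have ep := in_block_uniq hu hu'; have ed := prefix_inj (digit_lt u) (digit_lt u') ep.
apply/ffunP => tau; have [lt_t|ge_t] := ltnP tau t.*2.
  by apply: digit_inj; exact: ed.
have lt_s : (tau - t.*2 < n.*2 - t.*2)%N by rewrite ltn_sub2r// (leq_ltn_trans ge_t).
by have := eg (Ordinal lt_s); rewrite !ffunE /ext/= subnKC// !valK.
Qed.

Section mixed_coord.
Variables (A B : R) (a0 : nat).

Lemma sum_mixed_coord u :
  \sum_(a < n.+1) \sum_(b < n.+1) mixed q A B a0 (digit u) a b = tent A B (net_coord u).
Proof. by rewrite sum_mixed addnC even_part_large odd_part_large. Qed.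

(** Beyond depth [n] the even stream is exhausted, so the corners no longer depend on [a] and the
    difference in that direction is 0. *)
Lemma mixed_large u a b : mixed q A B a0 (digit u) a b != 0 ->
  (a0 <= n)%N -> (a0 + (minn a b).-1 <= n)%N.
Proof.
move=> nz a0n; have [//|] := leqP; case: a nz => [|a] nz; first by rewrite min0n addn0 ltnNge a0n.
move=> h; have an : (n <= a0 + a)%N by move: h; rewrite /minn; case: ifP; lia.
have cE b' : corner q A B a0 (digit u) a.+2 b' = corner q A B a0 (digit u) a.+1 b'.
  case: b' => //= b'; rewrite addnS -(subnKC an) -addnS.
  by rewrite !even_part_large.
by move: nz; rewrite /mixed !cE; rewrite (_ : _ + _ = 0) ?eqxx//; ring.
Qed.

(** The deepest corner is cut at [a0 + a] and [a0 + b]; these are the depths that enter the total in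
    [err_mx0]. *)
Lemma eq_mixed c c' a b :
  (forall t, (t < a0 + a)%N -> c t.*2 = c' t.*2) ->
  (forall t, (t < a0 + b)%N -> c t.*2.+1 = c' t.*2.+1) ->
  mixed q A B a0 c a b = mixed q A B a0 c' a b.
Proof.
move=> ea eb; suff cE a' b' : (a' <= a.+1)%N -> (b' <= b.+1)%N ->
    corner q A B a0 c a' b' = corner q A B a0 c' a' b'.
  by rewrite /mixed !cE// ?(ltnW (ltnSn _)).
case: a' b' => [|a'] [|b'] //=; rewrite !ltnS => ha hb.
congr (tent _ _ (_ + _)); apply: eq_bigr => t _; rewrite ?ea ?eb//.
  by rewrite (leq_trans (ltn_ord t))// leq_add2l.
by rewrite (leq_trans (ltn_ord t))// leq_add2l.
Qed.

End mixed_coord.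
End coordinates.

Lemma natr_card_set (R : pzSemiRingType) (T : finType) (P : pred T) :
  \sum_(x : T) (P x)%:R = #|[set x | P x]|%:R :> R.
Proof.
rewrite -sum1dep_card natr_sum [RHS]big_mkcond; apply: eq_bigr => x _.
by case: (P x).
Qed.

(** * Counting net points in boxes *)

Section block_count.
Variables (R : realFieldType) (F : finFieldType) (d n : nat) (alpha : 'I_d * bool -> F).
Hypotheses (alpha_inj : injective alpha) (d_gt0 : (0 < d)%N).
Local Notation q := #|F|.
Local Notation Q := (q%:R : R).
Local Notation W := {ffun 'I_d -> {ffun 'I_(n.*2) -> F}}.
Implicit Types (w : W) (f : {ffun 'I_n -> F}) (t : 'I_d -> nat) (v : 'I_d -> R).

Let Q_gt0 : 0 < Q. Proof. by rewrite ltr0n q_gt0. Qed.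
Let QX_gt0 m : 0 < Q ^+ m. Proof. exact: exprn_gt0. Qed.

Lemma card_arrays : #|{: W}|%:R = (Q ^+ n.*2) ^+ d.
Proof. by rewrite !card_ffun !card_ord !natrX. Qed.

Definition in_box t v w : bool := [forall i, in_block q (digit (w i)) (t i).*2 (v i)].

Lemma in_box_trunc t v e w : (forall s, t s.1 <= e s)%N ->
  in_box t v (trunc e w) = in_box t v w.
Proof.
move=> te; apply: eq_forallb => i; rewrite /in_block.
suff -> : prefix q (digit (trunc e w i)) (t i).*2 = prefix q (digit (w i)) (t i).*2 by [].
apply: eq_prefix => tau lt_tau.
have [lt_n|?] := ltnP tau n.*2; last by rewrite !digit_large.
rewrite (eq_digit (u := trunc e w i) (u' := w i) (tau := Ordinal lt_n))//.
rewrite truncE/= (_ : (tau./2 < _)%N)//; apply: leq_trans (te (i, odd tau)).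
by rewrite ltn_half_double.
Qed.

Lemma prod_in_block t v w :
  \prod_i (in_block q (digit (w i)) (t i).*2 (v i))%:R = (in_box t v w)%:R :> R.
Proof.
rewrite /in_box; case: forallP => [h|/forallP]; first by rewrite big1// => i _; rewrite h.
by rewrite negb_forall => /existsP[i /negbTE hi]; rewrite (bigD1 i)//= hi mul0r.
Qed.

Lemma card_in_box t v : (forall i, t i <= n)%N ->
  #|[set w | in_box t v w]|%:R <= (Q ^+ n.*2) ^+ d / Q ^+ (\sum_i (t i).*2).
Proof.
move=> tn; rewrite -natr_card_set.
rewrite (eq_bigr (fun w : W => \prod_i (in_block q (digit (w i)) (t i).*2 (v i))%:R)); last first.
  by move=> w _; rewrite prod_in_block.
rewrite -(bigA_distr_bigA (fun i (u : {ffun 'I_(n.*2) -> F}) => (in_block q (digit u) (t i).*2 (v i))%:R)).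
rewrite -[(Q ^+ _) ^+ d](_ : \prod_(i < d) Q ^+ n.*2 = _); last by rewrite prodr_const card_ord.
rewrite expr_sum -prodf_div; apply: ler_prod => i _.
by rewrite sumr_ge0//= natr_card_set card_block.
Qed.

(** The first [2 * t i] digits of coordinate [i] give depth [t i] in both of its streams, hence at
    least [n] Taylor coefficients in all. *)
Lemma box_inj t v f g : (n <= \sum_i (t i).*2)%N ->
  in_box t v (dig alpha f) -> in_box t v (dig alpha g) -> f = g.
Proof.
move=> nt /forallP hf /forallP hg; apply: (dig_inj alpha_inj (e := fun s => t s.1)).
  rewrite -(pair_big xpredT xpredT (fun i (b : bool) => t i))/=.
  by rewrite (eq_bigr (fun i => (t i).*2))// => i _; rewrite sum_nat_const card_bool mul2n.
apply/ffunP => i; apply/ffunP => tau; rewrite !truncE/=.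
case: ifP => // lt_t; apply: digit_inj.
apply: (prefix_inj (digit_lt _) (digit_lt _) (in_block_uniq (hf i) (hg i))).
by rewrite -ltn_half_double.
Qed.

(** A box of total depth at least [n] holds at most one net point, whence the 1. A coarser box holds
    exactly its share, by exact averaging, whence the quotient. *)
Lemma card_net_box t v : (forall i, t i <= n)%N ->
  #|[set f | in_box t v (dig alpha f)]|%:R <= 1 + Q ^+ n / Q ^+ (\sum_i (t i).*2).
Proof.
move=> tn; have [nt|/ltnW tn2] := leqP n (\sum_i (t i).*2).
  rewrite -[leLHS]addr0 lerD ?divr_ge0 ?(ltW (QX_gt0 _))// lern1.
  apply/card_le1_eqP => f g; rewrite !inE => hf hg; exact: box_inj nt hg hf.
rewrite -[leLHS]add0r lerD//.
have := sum_dig_depth alpha_inj (e := fun s => t s.1) (G := fun w => (in_box t v w)%:R : R) d_gt0.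
rewrite -(pair_big xpredT xpredT (fun i (b : bool) => t i))/=.
rewrite (eq_bigr (fun i => (t i).*2)); last by move=> i _; rewrite sum_nat_const card_bool mul2n.
move=> /(_ tn2 (fun w => esym (congr1 (fun b : bool => b%:R) (in_box_trunc v w (fun s => leqnn _))))).
rewrite !natr_card_set card_arrays natrX => E.
have p_gt0 : 0 < (Q ^+ n.*2) ^+ d by rewrite exprn_gt0.
rewrite -(ler_pM2l p_gt0) E mulrCA ler_pM2l//; exact: card_in_box.
Qed.

End block_count.

(** [T] is the base depth, [S] the total index of a term, [E1] and [E2] the exponents of its size
    and of the block carrying it. As [Q] is at least 4, the decay [Q ^- S] pays both for [2 ^- S],
    which makes the sum over the terms converge, and for [2 ^- (n - T)], since [n - T <= S]. *)
Lemma weight_bound (R : realFieldType) (Q : R) (n T S E1 E2 d : nat) : 4 <= Q ->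
  (T <= n)%N -> (n <= T + S)%N -> (T + S <= E1)%N -> (T.*2 + S.*2 <= E1 + E2 + d.*2)%N ->
  (1 + 2 * (Q ^+ n / Q ^+ E2)) / Q ^+ E1 <= 3 * Q ^+ d.*2 / (Q ^+ T * 2 ^+ (n - T) * 2 ^+ S).
Proof.
move=> Q4 Tn nTS TSE E12.
have Q_gt0 : 0 < Q by lra.
have Q1 : 1 <= Q by lra.
have QX m : 0 < Q ^+ m by rewrite exprn_gt0.
have two_gt0 m : 0 < 2 ^+ m :> R by rewrite exprn_gt0.
have pow2 : 2 ^+ (n - T) * 2 ^+ S <= Q ^+ S.
  apply: (@le_trans _ _ (4 ^+ S)); last by rewrite lerXn2r ?nnegrE//; lra.
  rewrite (_ : 4 = 2 * 2 :> R); last by ring.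
  rewrite exprMn ler_pM2r// ler_weXn2l ?ler1n//; lia.
apply: (@le_trans _ _ (3 * Q ^+ d.*2 / Q ^+ (T + S))); last first.
  rewrite ler_pM2l ?mulr_gt0// lef_pV2 ?posrE ?mulr_gt0// -mulrA exprD ler_pM2l//.
have h1 : 1 / Q ^+ E1 <= Q ^+ d.*2 / Q ^+ (T + S).
  rewrite ler_pdivrMr// mulrAC ler_pdivlMr// mul1r -exprD ler_weXn2l//; lia.
have h2 : Q ^+ n / Q ^+ E2 / Q ^+ E1 <= Q ^+ d.*2 / Q ^+ (T + S).
  rewrite -mulrA -invfM -exprD ler_pdivrMr// mulrAC ler_pdivlMr// -!exprD ler_weXn2l//; lia.
have -> : 3 * Q ^+ d.*2 / Q ^+ (T + S) = Q ^+ d.*2 / Q ^+ (T + S) + 2 * (Q ^+ d.*2 / Q ^+ (T + S)).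
  by rewrite -mulrA; ring.
by rewrite mulrDl -[2 * _ / _]mulrA; apply: lerD => //; rewrite ler_pM2l.
Qed.

Section quadrature.
Variables (R : realFieldType) (F : finFieldType) (d n : nat) (alpha : 'I_d * bool -> F).
Hypotheses (alpha_inj : injective alpha) (d_gt0 : (0 < d)%N) (q_ge4 : (4 <= #|F|)%N).
Local Notation q := #|F|.
Local Notation Q := (q%:R : R).
Local Notation W := {ffun 'I_d -> {ffun 'I_(n.*2) -> F}}.
Local Notation K := {ffun 'I_d -> 'I_n.+1 * 'I_n.+1}.
Variables (A B : 'I_d -> R) (a0 : 'I_d -> nat).
Hypotheses (AB : forall i, A i <= B i)
  (BA_le : forall i, B i - A i <= (Q ^+ (a0 i).*2)^-1).
Local Notation T := (\sum_i (a0 i).*2)%N.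
Hypothesis T_le : (T <= n)%N.
Implicit Types (w : W) (k : K) (f : {ffun 'I_n -> F}).

Let Q_gt0 : 0 < Q. Proof. by rewrite ltr0n q_gt0. Qed.
Let QX_gt0 m : 0 < Q ^+ m. Proof. exact: exprn_gt0. Qed.
Let Q_ge4 : 4 <= Q. Proof. by rewrite (ler_nat R 4). Qed.

Let mx k w : R := \prod_i mixed q (A i) (B i) (a0 i) (digit (w i)) (k i).1 (k i).2.

Let prod_tentE w : \prod_i tent (A i) (B i) (net_coord R (w i)) = \sum_k mx k w.
Proof.
rewrite -(bigA_distr_bigA (fun i (p : 'I_n.+1 * 'I_n.+1) =>
  mixed q (A i) (B i) (a0 i) (digit (w i)) p.1 p.2)).
by apply: eq_bigr => i _; rewrite -(sum_mixed_coord _ _ (a0 i)) pair_bigA.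
Qed.

Let err (G : W -> R) : R :=
  \sum_f G (dig alpha f) - Q ^+ n / (Q ^+ n.*2) ^+ d * \sum_w G w.

(** Such a term depends only on a truncation of total depth at most [n], which the net averages
    exactly. *)
Let err_mx0 k : (\sum_i ((a0 i).*2 + ((k i).1 + (k i).2)) <= n)%N -> err (mx k) = 0.
Proof.
move=> le_n; pose e (s : 'I_d * bool) := (a0 s.1 + (if s.2 then (k s.1).2 else (k s.1).1))%N.
have se : (\sum_s e s <= n)%N.
  rewrite -(pair_big xpredT xpredT (fun i (b : bool) => e (i, b)))/=.
  apply: leq_trans le_n; apply: leq_sum => i _; rewrite big_bool/e/=; lia.
have := sum_dig_depth alpha_inj (G := mx k) d_gt0 se.
rewrite card_arrays natrX => E; rewrite /err.
have p_gt0 : 0 < (Q ^+ n.*2) ^+ d by rewrite exprn_gt0.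
apply/eqP; rewrite subr_eq0 mulrAC -E; last first.
  move=> w; apply: eq_bigr => i _; apply: eq_mixed => t lt_t.
    have [lt_n|?] := ltnP t.*2 n.*2; last by rewrite !digit_large.
    rewrite (eq_digit (u := w i) (u' := trunc e w i) (tau := Ordinal lt_n))//.
    by rewrite truncE/= odd_double doubleK /e/= lt_t.
  have [lt_n|?] := ltnP t.*2.+1 n.*2; last by rewrite !digit_large.
  rewrite (eq_digit (u := w i) (u' := trunc e w i) (tau := Ordinal lt_n))//.
  by rewrite truncE/= odd_double/= uphalf_double /e/= lt_t.
by rewrite mulrAC divff ?mul1r// gt_eqF.
Qed.

Let t k i : nat := (a0 i + (minn (k i).1 (k i).2).-1)%N.
Let M k : R := \prod_i (2 * Q ^+ 2 / Q ^+ (a0 i + maxn (k i).1 (k i).2).*2).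

(** A nonzero term has, in each coordinate, a break point in its block; [c] chooses one of the three
    break points per coordinate. *)
Let sum_abs_mx (X : finType) (D : X -> W) k :
  \sum_x `|mx k (D x)| <= M k * \sum_(c : {ffun 'I_d -> 'I_3})
     #|[set x | in_box (t k) (fun i => brk (A i) (B i) (c i)) (D x)]|%:R.
Proof.
pose b (c : {ffun 'I_d -> 'I_3}) i := brk (A i) (B i) (c i).
rewrite mulr_sumr [leRHS](eq_bigr (fun c => \sum_x M k * (in_box (t k) (b c) (D x))%:R)); last first.
  by move=> c _; rewrite -natr_card_set mulr_sumr.
rewrite exchange_big/=; apply: ler_sum => x _; rewrite -mulr_sumr.
rewrite [X in M k * X](eq_bigr (fun c : {ffun 'I_d -> 'I_3} => \prod_i
    (in_block q (digit (D x i)) (t k i).*2 (brk (A i) (B i) (c i)))%:R)); last first.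
  by move=> c _; rewrite prod_in_block.
rewrite -(bigA_distr_bigA (fun i c => (in_block q (digit (D x i)) (t k i).*2 (brk (A i) (B i) c))%:R)).
rewrite normr_prod -big_split/=; apply: ler_prod => i _; rewrite normr_ge0/=.
have [->|nz] := eqVneq (mixed q (A i) (B i) (a0 i) (digit (D x i)) (k i).1 (k i).2) 0.
  by rewrite normr0 mulr_ge0 ?divr_ge0 ?mulr_ge0 ?sumr_ge0 ?(ltW (QX_gt0 _)).
have := mixed_support (q_gt0 F) (AB i) (BA_le i) (digit_lt (D x i)) nz.
move=> /existsP[c hc]; apply: le_trans (mixed_bound (q_gt0 F) (AB i) (BA_le i) (digit_lt (D x i)) _ _) _.
rewrite ler_peMr ?divr_ge0 ?mulr_ge0 ?(ltW (QX_gt0 _))//.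
by rewrite (bigD1 c)//= hc lerDl sumr_ge0.
Qed.

Let bound_ge0 k : 0 <= 3 * (6 * Q ^+ 4) ^+ d / (Q ^+ T * 2 ^+ (n - T)) *
  \prod_i (2^-1 ^+ (k i).1 * 2^-1 ^+ (k i).2).
Proof.
apply: mulr_ge0; last by apply: prodr_ge0 => i _; apply: mulr_ge0; rewrite exprn_ge0// invr_ge0.
by apply: divr_ge0; apply: mulr_ge0; rewrite ?exprn_ge0// ?mulr_ge0// ltW.
Qed.

(** The net sum and the mean are bounded separately by counting boxes. In each coordinate 6 is 2
    from [mixed_bound] times 3 break points, and [Q ^+ 4] is [Q ^+ 2] from [mixed_bound] times
    [Q ^+ 2] lost to the predecessor in [t]. *)
Let err_mx_le k : (n <= \sum_i ((a0 i).*2 + ((k i).1 + (k i).2)))%N ->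
  `|err (mx k)| <= 3 * (6 * Q ^+ 4) ^+ d / (Q ^+ T * 2 ^+ (n - T)) *
    \prod_i (2^-1 ^+ (k i).1 * 2^-1 ^+ (k i).2).
Proof.
move=> n_le; have two_gt0 m : 0 < 2 ^+ m :> R by rewrite exprn_gt0.
(* With a depth beyond [n] every value of the term vanishes by [mixed_large]; the box counts need
   depths at most [n]. *)
have [/forallP tn|] := boolP [forall i, t k i <= n]%N; last first.
  rewrite negb_forall => /existsP[i ti].
  have mx0 w : mx k w = 0.
    rewrite /mx (bigD1 i)//=; have [->|nz] := eqVneq (mixed q (A i) (B i) (a0 i) (digit (w i)) (k i).1 (k i).2) 0.
      by rewrite mul0r.
    move: ti; rewrite /t (mixed_large nz)//.
    by apply: leq_trans T_le; rewrite (bigD1 i)//= -addnn -addnA leq_addr.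
  have -> : err (mx k) = 0.
    by rewrite /err big1 ?[X in _ * X]big1 ?mulr0 ?subrr// => *; exact: mx0.
  by rewrite normr0 bound_ge0.
pose E1 := (\sum_i (a0 i + maxn (k i).1 (k i).2).*2)%N.
pose E2 := (\sum_i (t k i).*2)%N.
pose S := (\sum_i ((k i).1 + (k i).2))%N.
have ME : M k = (2 * Q ^+ 2) ^+ d / Q ^+ E1.
  by rewrite /M prodf_div prodr_const card_ord expr_sum.
have M0 : 0 <= M k by rewrite ME divr_ge0 ?exprn_ge0 ?mulr_ge0 ?ltW.
have c3 (x : R) : \sum_(c : {ffun 'I_d -> 'I_3}) x = 3 ^+ d * x.
  by rewrite sumr_const card_ffun !card_ord -[LHS]mulr_natl natrX.
pose b (c : {ffun 'I_d -> 'I_3}) i := brk (A i) (B i) (c i).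
have hf : `|\sum_f mx k (dig alpha f)| <= M k * (3 ^+ d * (1 + Q ^+ n / Q ^+ E2)).
  apply: le_trans (ler_norm_sum _ _ _) _.
  apply: le_trans (sum_abs_mx (@dig F d n alpha) k) _.
  rewrite ler_wpM2l// -c3; apply: ler_sum => c _.
  exact: card_net_box.
have p_gt0 : 0 < (Q ^+ n.*2) ^+ d by rewrite exprn_gt0.
have hw : `|Q ^+ n / (Q ^+ n.*2) ^+ d * \sum_w mx k w| <= M k * (3 ^+ d * (Q ^+ n / Q ^+ E2)).
  have c0 : 0 < Q ^+ n / (Q ^+ n.*2) ^+ d by rewrite divr_gt0.
  rewrite normrM (ger0_norm (ltW c0)).
  apply: (@le_trans _ _ (Q ^+ n / (Q ^+ n.*2) ^+ d * (M k * (3 ^+ d * ((Q ^+ n.*2) ^+ d / Q ^+ E2))))).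
    rewrite ler_pM2l//; apply: le_trans (ler_norm_sum _ _ _) _.
    apply: le_trans (sum_abs_mx id k) _.
    rewrite ler_wpM2l// -c3; apply: ler_sum => c _; exact: card_in_box.
  by rewrite le_eqVlt; apply/orP; left; apply/eqP; field; rewrite !gt_eqF.
apply: le_trans (ler_normB _ _) _; apply: le_trans (lerD hf hw) _.
rewrite [leLHS](_ : _ = (6 * Q ^+ 2) ^+ d * ((1 + 2 * (Q ^+ n / Q ^+ E2)) / Q ^+ E1)); last first.
  rewrite ME (_ : 6 * Q ^+ 2 = (2 * Q ^+ 2) * 3); last by ring.
  by rewrite [_ ^+ d in RHS]exprMn; ring.
rewrite [leRHS](_ : _ = (6 * Q ^+ 2) ^+ d * (3 * Q ^+ d.*2 / (Q ^+ T * 2 ^+ (n - T) * 2 ^+ S))); last first.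
  rewrite (_ : 6 * Q ^+ 4 = (6 * Q ^+ 2) * Q ^+ 2); last by ring.
  rewrite [_ ^+ d in LHS]exprMn -exprM mul2n.
  rewrite (eq_bigr (fun i => 2^-1 ^+ ((k i).1 + (k i).2))); last by move=> i _; rewrite exprD.
  by rewrite -expr_sum -/S exprVn !invfM; ring.
rewrite ler_pM2l ?exprn_gt0 ?mulr_gt0//; apply: weight_bound => //.
- by rewrite -big_split.
- rewrite -big_split/=; apply: leq_sum => i _; rewrite /maxn; case: ifP; lia.
- rewrite -!mul2n !big_distrr/= -[(2 * d)%N]mulnC -[X in (_ <= _ + X * _)%N]card_ord -sum_nat_const -!big_split/=.
  by apply: leq_sum => i _; rewrite /t /maxn /minn; case: ifP; lia.
Qed.

Lemma sum_pow_half m : \sum_(a < m) 2^-1 ^+ a <= 2 :> R.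
Proof.
suff -> : \sum_(a < m) 2^-1 ^+ a = 2 - 2 * 2^-1 ^+ m :> R.
  by rewrite gerBl mulr_ge0// exprn_ge0// invr_ge0.
elim: m => [|m IHm]; first by rewrite big_ord0 expr0 mulr1 subrr.
by rewrite big_ord_recr/= IHm exprS; field.
Qed.

Lemma net_quadrature :
  `|\sum_(f : {ffun 'I_n -> F}) \prod_i tent (A i) (B i) (net_coord R (dig alpha f i)) -
    Q ^+ n * \prod_i ((\sum_(u : {ffun 'I_(n.*2) -> F}) tent (A i) (B i) (net_coord R u)) / Q ^+ n.*2)| <=
  3 * (24 * Q ^+ 4) ^+ d / (Q ^+ T * 2 ^+ (n - T)).
Proof.
pose G (w : W) := \prod_i tent (A i) (B i) (net_coord R (w i)).
have -> : Q ^+ n * \prod_i ((\sum_(u : {ffun 'I_(n.*2) -> F}) tent (A i) (B i) (net_coord R u)) / Q ^+ n.*2) =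
    Q ^+ n / (Q ^+ n.*2) ^+ d * \sum_w G w.
  by rewrite prodf_div prodr_const card_ord bigA_distr_bigA/=; ring.
rewrite (_ : _ - _ = \sum_k err (mx k)); last first.
  rewrite /err sumrB -mulr_sumr [X in _ = X - _]exchange_big/= [X in _ = _ - _ * X]exchange_big/=.
  by congr (_ - _ * _); apply: eq_bigr => w _; rewrite -prod_tentE.
have bound k : `|err (mx k)| <= 3 * (6 * Q ^+ 4) ^+ d / (Q ^+ T * 2 ^+ (n - T)) *
    \prod_i (2^-1 ^+ (k i).1 * 2^-1 ^+ (k i).2).
  have [h|/ltnW h] := leqP (\sum_i ((a0 i).*2 + ((k i).1 + (k i).2))) n.
    by rewrite err_mx0// normr0 bound_ge0.
  exact: err_mx_le.
apply: le_trans (ler_norm_sum _ _ _) _.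
apply: le_trans (ler_sum _ (fun k _ => bound k)) _.
rewrite -mulr_sumr -(bigA_distr_bigA (fun i (p : 'I_n.+1 * 'I_n.+1) => 2^-1 ^+ p.1 * 2^-1 ^+ p.2)).
rewrite prodr_const card_ord.
rewrite -(pair_bigA _ (fun a b : 'I_n.+1 => 2^-1 ^+ a * 2^-1 ^+ b))/=.
rewrite -big_distrlr/=.
(* In each coordinate the two geometric series contribute [2 * 2]. *)
have -> : 3 * (24 * Q ^+ 4) ^+ d / (Q ^+ T * 2 ^+ (n - T)) =
    3 * (6 * Q ^+ 4) ^+ d / (Q ^+ T * 2 ^+ (n - T)) * (2 * 2) ^+ d.
  rewrite (_ : 24 * Q ^+ 4 = (6 * Q ^+ 4) * (2 * 2)); last by ring.
  by rewrite [_ ^+ d in LHS]exprMn [3 * (_ * _)]mulrA mulrAC.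
have half0 m : 0 <= \sum_(a < m) 2^-1 ^+ a :> R.
  by apply: sumr_ge0 => a _; rewrite exprn_ge0// invr_ge0.
apply: ler_wpM2l; first by rewrite divr_ge0 ?mulr_ge0 ?exprn_ge0 ?mulr_ge0 ?ltW.
apply: lerXn2r; rewrite ?nnegrE ?mulr_ge0 ?half0//.
by apply: ler_pM; rewrite ?half0 ?sum_pow_half.
Qed.

(** The [n.*2] digits of a single coordinate are free, so it runs through the uniform grid once. *)
Lemma sum_coord (h : R -> R) :
  \sum_(u : {ffun 'I_(n.*2) -> F}) h (net_coord R u) = \sum_(X < q ^ n.*2) h (X%:R / Q ^+ n.*2).
Proof.
pose g (u : {ffun 'I_(n.*2) -> F}) := Ordinal (prefix_lt n.*2 (digit_lt u)).
have g_inj : injective g.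
  move=> u u' /(congr1 val)/= E; apply/ffunP => tau; apply: digit_inj.
  exact: prefix_inj (digit_lt u) (digit_lt u') E _ (ltn_ord tau).
have g_bij : bijective g by apply: inj_card_bij => //; rewrite card_ffun !card_ord.
rewrite [RHS](reindex g)/=; last exact: onW_bij.
by apply: eq_bigr => u _; rewrite /net_coord even_odd_prefix ?q_gt0.
Qed.

(** The factors are replaced one at a time. *)
Lemma dist_prod_le (r : seq 'I_d) (x y c : 'I_d -> R) e :
  (forall i, 0 <= x i <= c i) -> (forall i, 0 <= y i <= c i) ->
  (forall i, `|x i - y i| <= e * c i) ->
  `|\prod_(i <- r) x i - \prod_(i <- r) y i| <= (size r)%:R * e * \prod_(i <- r) c i.
Proof.
move=> xc yc xy; elim: r => [|i r IHr]; first by rewrite !big_nil subrr normr0 !mul0r.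
rewrite !big_cons/=; set X := \prod_(_ <- r) x _; set Y := \prod_(_ <- r) y _; set C := \prod_(_ <- r) c _.
have /andP[x0 xci] := xc i; have /andP[y0 yci] := yc i.
have XC : X <= C by apply: ler_prod.
have X0 : 0 <= X by apply: prodr_ge0 => j _; case/andP: (xc j).
rewrite (_ : _ - _ = (x i - y i) * X + y i * (X - Y)); last by ring.
apply: le_trans (ler_normD _ _) _; rewrite !normrM (ger0_norm X0) (ger0_norm y0).
rewrite -natr1 (_ : (_ + 1) * e * _ = (e * c i) * C + c i * ((size r)%:R * e * C)); last by ring.
by apply: lerD; apply: ler_pM.
Qed.

Lemma net_tent_error : (forall i, 0 <= A i) -> (forall i, B i <= 1) ->
  `|\sum_(f : {ffun 'I_n -> F}) \prod_i tent (A i) (B i) (net_coord R (dig alpha f i)) -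
    Q ^+ n * \prod_i ((B i - A i) ^+ 2 / 4)| <=
  (3 * (24 * Q ^+ 4) ^+ d + d%:R * 5 ^+ d) / (Q ^+ T * 2 ^+ (n - T)).
Proof.
move=> A0 B1; have two_gt0 m : 0 < 2 ^+ m :> R by rewrite exprn_gt0.
have Q1 : 1 <= Q by have := Q_ge4; lra.
rewrite mulrDl; apply: le_trans (ler_distD _ _ _) (lerD net_quadrature _).
rewrite -mulrBr normrM (ger0_norm (ltW (QX_gt0 n))).
(* The 5 leaves room for the integral, at most 1/4 of [(Q ^+ (a0 i).*2.*2)^-1], plus the Riemann
   error, at most 4 times it. *)
pose m i : R := 5 / Q ^+ (a0 i).*2.*2.
have aT i : ((a0 i).*2 <= T)%N by rewrite (bigD1 i)//= leq_addr.
have m_ge i : 5 / Q ^+ n.*2 <= m i.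
  rewrite ler_pM2l// lef_pV2 ?posrE// ler_weXn2l//.
  by rewrite leq_double (leq_trans (aT i)).
pose I i : R := (B i - A i) ^+ 2 / 4.
pose mean i := (\sum_(u : {ffun 'I_(n.*2) -> F}) tent (A i) (B i) (net_coord R u)) / Q ^+ n.*2.
have mean_I i : `|mean i - I i| <= 4 / Q ^+ n.*2.
  rewrite /mean sum_coord -natrX; apply: sum_tent => //.
  by rewrite expn_gt0 q_gt0.
have I_le i : 0 <= I i <= (Q ^+ (a0 i).*2.*2)^-1 / 4.
  rewrite /I divr_ge0 ?sqr_ge0//= ler_pM2r ?invr_gt0//.
  rewrite -[(a0 i).*2.*2]muln2 exprM -exprVn.
  by apply: lerXn2r; rewrite ?nnegrE ?subr_ge0 ?invr_ge0 ?(ltW (QX_gt0 _)).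
have nn (i : 'I_d) : 0 < (Q ^+ (a0 i).*2.*2)^-1 by rewrite invr_gt0.
have le_nm i : (Q ^+ n.*2)^-1 <= (Q ^+ (a0 i).*2.*2)^-1.
  by have := m_ge i; rewrite /m ler_pM2l.
have Im i : 0 <= I i <= m i.
  by have /andP[? ?] := I_le i; have := nn i; rewrite /m => ?; apply/andP; split; lra.
have mm i : 0 <= mean i <= m i.
  have m0 : 0 <= mean i by rewrite divr_ge0 ?sumr_ge0 ?ltW// => u _; exact: tent_ge0.
  rewrite m0/=; have := mean_I i; rewrite ler_norml => /andP[_].
  by have /andP[? ?] := I_le i; have := nn i; have := le_nm i; rewrite /m; lra.
(* This relative error is uniform in [i]; multiplied by [Q ^+ n] and the product of the [m i] it
   leaves a constant over [Q ^+ n]. *)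
have dm i : `|mean i - I i| <= (Q ^+ T.*2 / Q ^+ n.*2) * m i.
  apply: le_trans (mean_I i) _; rewrite mulrAC ler_pM2r ?invr_gt0//.
  rewrite /m mulrCA; apply: (@le_trans _ _ (5 * 1)); first by lra.
  rewrite ler_pM2l// ler_pdivlMr// mul1r ler_weXn2l// leq_double; exact: aT.
have := dist_prod_le (index_enum 'I_d) mm Im dm.
rewrite [size _](_ : _ = d); last first.
  by rewrite -sum1_size sum1_card card_ord.
move=> dist; apply: le_trans (ler_wpM2l (ltW (QX_gt0 n)) dist) _.
rewrite prodf_div prodr_const card_ord.
rewrite (_ : \prod_i Q ^+ (a0 i).*2.*2 = Q ^+ T.*2); last first.
  rewrite -expr_sum; congr (_ ^+ _); rewrite -mul2n big_distrr/=.
  by apply: eq_bigr => i _; rewrite mul2n.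
rewrite [leLHS](_ : _ = d%:R * 5 ^+ d * (Q ^+ n)^-1); last first.
  by rewrite -[n.*2]addnn exprD; field; rewrite !gt_eqF.
rewrite ler_wpM2l ?mulr_ge0 ?exprn_ge0// lef_pV2 ?posrE ?mulr_gt0//.
have -> : Q ^+ n = Q ^+ T * Q ^+ (n - T) by rewrite -exprD subnKC.
by rewrite ler_pM2l// lerXn2r ?nnegrE ?ltW//; have := Q_ge4; lra.
Qed.

End quadrature.

(** * The point set *)

Section point_set.
Variables (R : realType) (F : finFieldType) (dm k n N : nat).
Local Notation d := dm.+1.
Variable alpha : 'I_d * bool -> F.
Hypotheses (alpha_inj : injective alpha) (k_gt1 : (1 < k)%N) (card_F : #|F| = (2 ^ k)%N).
Hypotheses (N_gt : ((2 ^ k) ^ n.-1 < N)%N) (N_le : (N <= (2 ^ k) ^ n)%N).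
Local Notation q := #|F|.
Local Notation Q := (q%:R : R).
Implicit Types (f : {ffun 'I_n -> F}) (j : d.-tuple nat).

Let Q_gt0 : 0 < Q. Proof. by rewrite ltr0n q_gt0. Qed.
Let QX_gt0 m : 0 < Q ^+ m. Proof. exact: exprn_gt0. Qed.
Let N_gt0 : (0 < N)%N. Proof. exact: leq_ltn_trans N_gt. Qed.

Definition stretch : R := Q ^+ n / N%:R.
Definition scale (i : 'I_d) : R := if i == ord0 then stretch else 1.

Lemma stretch_ge1 : 1 <= stretch.
Proof. by rewrite ler_pdivlMr ?ltr0n// mul1r -natrX ler_nat card_F. Qed.

Lemma stretch_le : (0 < n)%N -> stretch <= Q.
Proof.
move=> n0; rewrite ler_pdivrMr ?ltr0n// -[n in Q ^+ n]prednK// exprS ler_pM2l//.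
by rewrite -natrX ler_nat card_F ltnW.
Qed.

Lemma scale_ge1 i : 1 <= scale i.
Proof. by rewrite /scale; case: ifP => // _; exact: stretch_ge1. Qed.

Lemma scale_gt0 i : 0 < scale i.
Proof. exact: lt_le_trans (scale_ge1 i). Qed.

Lemma prod_scale : \prod_i scale i = stretch.
Proof. by rewrite big_ord_recl big1 ?mulr1// => i _. Qed.

Definition point f : d.-tuple R := [tuple scale i * net_coord R (dig alpha f i) | i < d].

Definition selected : {set {ffun 'I_n -> F}} :=
  [set f | (prefix q (digit (dig alpha f ord0)) n < N)%N].

Definition points : {fset d.-tuple R} := [fset point f | f in selected]%fset.

(** The first [n] digits of coordinate 0 alternate between its two streams, starting with the even
    one. They reveal [uphalf n] and [n./2] Taylor coefficients, [n] in total, enough to determine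
    the polynomial. *)
Lemma prefix_net_inj f g :
  prefix q (digit (dig alpha f ord0)) n = prefix q (digit (dig alpha g ord0)) n -> f = g.
Proof.
move=> fg; pose e (s : 'I_d * bool) := if s.1 == ord0 then if s.2 then n./2 else uphalf n else 0%N.
apply: (dig_inj alpha_inj (e := e)).
  rewrite -(pair_big xpredT xpredT (fun i (b : bool) => e (i, b)))/= big_ord_recl big_bool/e/=.
  by rewrite (leq_trans _ (leq_addr _ _))// uphalf_half addnCA addnn odd_double_half.
apply/ffunP => i; apply/ffunP => tau; rewrite !truncE /e/=; case: eqP => [->|_//].
case: ifP => // lt_tau; apply: digit_inj; apply: (prefix_inj (digit_lt _) (digit_lt _) fg).
move: lt_tau (odd_double_half tau) (odd_double_half n); rewrite uphalf_half.
by case: (odd tau); case: (odd n); lia.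
Qed.

Lemma coord_in_block u : in_block q (digit u) n (net_coord R (n := n) (F := F) u).
Proof.
rewrite /in_block /net_coord even_odd_prefix ?q_gt0// -addnn exprD.
have /andP[h1 h2] := prefix_bounds n n (digit_lt u).
rewrite -mulrA invfM mulrAC mulVf ?mul1r ?gt_eqF// -natrX.
rewrite ler_pdivlMr ?ltr_pdivrMr ?ltr0n ?expn_gt0 ?q_gt0// -!natrM ler_nat ltr_nat.
by rewrite h1 h2.
Qed.

Lemma coord_ge0 u : 0 <= net_coord R (n := n) (F := F) u.
Proof. by rewrite /net_coord even_odd_prefix ?q_gt0// divr_ge0// ltW. Qed.

Lemma coord_lt1 u : net_coord R (n := n) (F := F) u < 1.
Proof.
rewrite /net_coord even_odd_prefix ?q_gt0// ltr_pdivrMr// mul1r -natrX ltr_nat.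
exact: prefix_lt (digit_lt u).
Qed.

Lemma selectedE f : (f \in selected) = (stretch * net_coord R (dig alpha f ord0) < 1).
Proof.
rewrite inE; have /andP[h1 h2] := coord_in_block (dig alpha f ord0).
rewrite /stretch mulrAC ltr_pdivrMr ?ltr0n// mul1r mulrC; apply/idP/idP => h.
  by apply: lt_le_trans h2 _; rewrite ler_nat.
by have := le_lt_trans h1 h; rewrite ltr_nat.
Qed.

Lemma point_inj : injective point.
Proof.
move=> f g /(congr1 (fun t : d.-tuple R => tnth t ord0)); rewrite !tnth_mktuple.
move=> /(mulfI (lt0r_neq0 (scale_gt0 _))) E; apply: prefix_net_inj.
have := coord_in_block (dig alpha g ord0); rewrite -E => h.
exact: in_block_uniq (coord_in_block _) h.
Qed.

(** The leading [n] digits of coordinate 0 take each value below [q ^ n] exactly once, so exactly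
    [N] of them are below [N]. *)
Lemma card_selected : #|selected| = N.
Proof.
pose g f := Ordinal (prefix_lt n (digit_lt (dig alpha f ord0))).
have g_inj : injective g by move=> f f' /(congr1 val)/prefix_net_inj.
have g_bij : bijective g by apply: inj_card_bij => //; rewrite card_ffun !card_ord.
have gN : (N <= q ^ n)%N by rewrite card_F.
rewrite -(card_imset _ g_inj) -[RHS]card_ord.
rewrite -(card_codom (f := widen_ord gN)); last by move=> x y /(congr1 val)/= /val_inj.
apply: eq_card => x; apply/imsetP/codomP => [[f fs ->]|[y ->]].
  by move: fs; rewrite inE => fs; exists (Ordinal fs); apply: val_inj.
have [h hK Kh] := g_bij; exists (h (widen_ord gN y)); last by rewrite Kh.
by rewrite inE; have /(congr1 val)/= -> := Kh (widen_ord gN y).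
Qed.

Lemma card_points : #|` points| = N.
Proof. by rewrite card_imfset/=; [rewrite -card_selected cardE|exact: point_inj]. Qed.

Lemma points_in_cube z : z \in points -> @unit_cube R d z.
Proof.
move=> /imfsetP[f /= fs ->] i; rewrite tnth_mktuple in_itv/= mulr_ge0 ?coord_ge0 ?(ltW (scale_gt0 _))//=.
rewrite /scale; case: eqP => [->|_]; last by rewrite mul1r coord_lt1.
by rewrite -selectedE.
Qed.

Lemma sum_points (h : d.-tuple R -> R) :
  \sum_(z <- points) h z = \sum_(f in selected) h (point f).
Proof. by rewrite big_imfset/=; [rewrite big_enum|move=> ? ? _ _; exact: point_inj]. Qed.

(** [k.*2] binary digits make up one pair of base [q] digits, one from each stream; [depth] counts
    the complete pairs. *)
Definition depth j (i : 'I_d) : nat := (tnth j i %/ k.*2)%N.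
(* [Q ^+ level j] is [2 ^+ sumn j] up to a bounded factor. *)
Definition level j : nat := (\sum_i (depth j i).*2)%N.

Lemma card_F_natr : Q = 2 ^+ k.
Proof. by rewrite card_F natrX. Qed.

Lemma depth_le j i : Q ^+ (depth j i).*2 <= 2 ^+ tnth j i.
Proof.
rewrite card_F_natr -exprM ler_weXn2l ?ler1n// (_ : k * _ = depth j i * k.*2)%N ?leq_divM//.
by rewrite -!muln2 mulnCA.
Qed.

Lemma depth_ge j i : 2 ^+ tnth j i <= Q ^+ (depth j i).*2 * Q ^+ 2.
Proof.
rewrite card_F_natr -!exprM -exprD ler_weXn2l ?ler1n//.
rewrite (_ : k * _ + _ = (depth j i).+1 * k.*2)%N; last by rewrite -!muln2 mulnCA mulSnr.
by apply/ltnW/ltn_ceil; rewrite double_gt0 ltnW.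
Qed.

Lemma level_le j : Q ^+ level j <= 2 ^+ sumn j.
Proof.
rewrite sumnE big_tuple !expr_sum; apply: ler_prod => i _.
by rewrite ltW//= depth_le.
Qed.

Lemma level_ge j : 2 ^+ sumn j <= Q ^+ level j * (Q ^+ 2) ^+ d.
Proof.
rewrite sumnE big_tuple !expr_sum.
rewrite -[d in X in _ <= _ * X]card_ord -prodr_const -big_split/=; apply: ler_prod => i _.
by rewrite exprn_ge0//= depth_ge.
Qed.

Section one_box.
Variables (j m : d.-tuple nat).
Hypothesis jm : dyadic_index j m.

Let a i : R := (tnth m i)%:R / 2 ^+ tnth j i.
Let b i : R := (tnth m i).+1%:R / 2 ^+ tnth j i.
Let p2_gt0 i : 0 < 2 ^+ tnth j i :> R. Proof. by rewrite exprn_gt0. Qed.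
Let ab i : b i - a i = (2 ^+ tnth j i)^-1.
Proof. by rewrite -mulrBl -natrB// subSnn mul1r. Qed.
Let A i : R := a i / scale i.
Let B i : R := b i / scale i.
Let AB i : B i - A i = (2 ^+ tnth j i)^-1 / scale i.
Proof. by rewrite -mulrBl ab. Qed.
Let A_ge0 i : 0 <= A i.
Proof. by rewrite !divr_ge0 ?(ltW (scale_gt0 _))// exprn_ge0. Qed.
Let b_le1 i : b i <= 1.
Proof. by rewrite ler_pdivrMr// mul1r -natrX ler_nat; exact: jm. Qed.
Let B_le1 i : B i <= 1.
Proof.
by rewrite ler_pdivrMr ?scale_gt0// mul1r (le_trans (b_le1 i))// scale_ge1.
Qed.
Let A_le_B i : A i <= B i.
Proof. by rewrite -subr_ge0 AB divr_ge0 ?invr_ge0 ?(ltW (scale_gt0 _))// ltW. Qed.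
Let AB_le i : B i - A i <= (Q ^+ (depth j i).*2)^-1.
Proof.
rewrite AB; apply: (@le_trans _ _ (2 ^+ tnth j i)^-1).
  by rewrite ler_pdivrMr ?scale_gt0// ler_peMr ?scale_ge1// invr_ge0 ltW.
by rewrite lef_pV2 ?posrE// depth_le.
Qed.

(** Stretching a coordinate shrinks its tent. The sum may run over all polynomials because an
    unselected one has stretched first coordinate at least 1, where the tent is 0. *)
Lemma sum_points_tent :
  \sum_(z <- points) \prod_i tent (a i) (b i) (tnth z i) =
  stretch * \sum_(f : {ffun 'I_n -> F}) \prod_i tent (A i) (B i) (net_coord R (dig alpha f i)).
Proof.
rewrite sum_points big_mkcond mulr_sumr/=; apply: eq_bigr => f _.
have -> : stretch * \prod_i tent (A i) (B i) (net_coord R (dig alpha f i)) =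
    \prod_i tent (a i) (b i) (tnth (point f) i).
  rewrite -prod_scale -big_split; apply: eq_bigr => i _.
  by rewrite tnth_mktuple tentZ ?scale_gt0.
case: ifPn => //; rewrite selectedE -leNgt => h; rewrite (bigD1 ord0)//=.
suff -> : tent (a ord0) (b ord0) (tnth (point f) ord0) = 0 by rewrite mul0r.
apply/eqP/negPn/negP => /tent_gt0/andP[_]; rewrite tnth_mktuple ltNge.
by rewrite (le_trans (b_le1 _)).
Qed.

Lemma low_error : (0 < n)%N -> (level j <= n)%N ->
  `|\sum_(z <- points) \prod_i tent (a i) (b i) (tnth z i) -
    N%:R * \prod_i ((2 ^+ tnth j i)^-1 ^+ 2 / 4)| <=
  Q * (3 * (24 * Q ^+ 4) ^+ d + d%:R * 5 ^+ d) / (Q ^+ level j * 2 ^+ (n - level j)).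
Proof.
move=> n0 le_n; rewrite sum_points_tent.
(* The squared scales multiply to [stretch ^+ 2], and [stretch * Q ^+ n / stretch ^+ 2] is [N]. *)
have -> : N%:R * \prod_i ((2 ^+ tnth j i)^-1 ^+ 2 / 4) =
    stretch * (Q ^+ n * \prod_i ((B i - A i) ^+ 2 / 4)).
  rewrite [X in _ = _ * (_ * X)](eq_bigr (fun i => ((2 ^+ tnth j i)^-1 ^+ 2 / 4) / (scale i ^+ 2))); last first.
    by move=> i _; rewrite AB expr_div_n mulrAC.
  rewrite [in RHS]prodf_div [\prod_i scale i ^+ 2]prodrXl prod_scale /stretch; field.
  by rewrite !gt_eqF// ltr0n.
rewrite -mulrBr normrM ger0_norm; last by rewrite (le_trans ler01 stretch_ge1).
rewrite -[Q * _ / _]mulrA; apply: ler_pM => //; first by rewrite (le_trans ler01 stretch_ge1).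
  exact: stretch_le.
apply: net_tent_error => //.
by rewrite card_F (@leq_exp2l 2 2).
Qed.

(* Each interval meets at most two blocks of depth [depth j i], and at this
   depth the blocks determine the polynomial. *)
Lemma card_points_box : (n <= level j)%N ->
  (#|[set f | point f \in @dyadic_box R d j m]| <= 2 ^ d)%N.
Proof.
move=> n_le; pose t i := (depth j i).*2.
pose base i := Num.truncn (A i * Q ^+ t i).
pose c f : {ffun 'I_d -> bool} := [ffun i => prefix q (digit (dig alpha f i)) (t i) == base i].
rewrite -[2%N]card_bool -[X in (_ <= _ ^ X)%N](card_ord d) -card_ffun.
apply: (@leq_card_in _ _ c) => f g; rewrite !inE => hf hg /ffunP cfg.
have two_values h i : @dyadic_box R d j m (point h) ->
    prefix q (digit (dig alpha h i)) (t i) = base i \/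
    prefix q (digit (dig alpha h i)) (t i) = (base i).+1.
  move=> /(_ i); rewrite tnth_mktuple /Defs.dyadic_itv/= in_itv/= => /andP[h1 h2].
  have {}h1 : A i <= net_coord R (dig alpha h i) by rewrite ler_pdivrMr ?scale_gt0// mulrC.
  have {}h2 : net_coord R (dig alpha h i) < B i by rewrite ltr_pdivlMr ?scale_gt0// mulrC.
  have /andP[h3 h4] : in_block q (digit (dig alpha h i)) (t i) (net_coord R (dig alpha h i)).
    (* Both streams are padded to depth [n + depth j i], because [in_block_parts] needs cuts at
       least as deep as [depth j i], which may exceed [n]. *)
    rewrite /net_coord -(even_part_large R _ (depth j i)) -(odd_part_large R _ (depth j i)).
    by apply: in_block_parts => //; rewrite ?q_gt0 ?leq_addl//; exact: digit_lt.
  have /andP[h5 h6] := truncn_itv (mulr_ge0 (A_ge0 i) (ltW (QX_gt0 (t i)))).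
  have AB1 : B i * Q ^+ t i <= A i * Q ^+ t i + 1.
    by rewrite -lerBlDl -mulrBl -ler_pdivlMr// mul1r AB_le.
  have l1 : ((base i)%:R : R) < (prefix q (digit (dig alpha h i)) (t i)).+1%:R.
    by apply: le_lt_trans h5 _; apply: le_lt_trans h4; rewrite ler_pM2r.
  have l2 : ((prefix q (digit (dig alpha h i)) (t i))%:R : R) < (base i).+2%:R.
    apply: le_lt_trans h3 _; rewrite -(ltr_pM2r (QX_gt0 (t i))) in h2.
    apply: lt_le_trans h2 _; apply: le_trans AB1 _.
    by rewrite -[(base i).+2%:R]natr1 lerD2r ltW.
  move: l1 l2; rewrite !ltr_nat; move: (prefix _ _ _) (base i) => x y xy yx.
  by case: (ltngtP x y) => xy2; [lia|right; lia|left].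
apply: (dig_inj alpha_inj (e := fun s => depth j s.1)).
  rewrite -(pair_big xpredT xpredT (fun i (b : bool) => depth j i))/=.
  rewrite (eq_bigr (fun i => (depth j i).*2))// => i _.
  by rewrite sum_nat_const card_bool mul2n.
apply/ffunP => i; apply/ffunP => tau; rewrite !truncE/=; case: ifP => // lt_tau.
apply: digit_inj; apply: (prefix_inj (digit_lt _) (digit_lt _) (s := t i)); last first.
  by rewrite /t -ltn_half_double.
have := cfg i; rewrite [c f i]ffunE [c g i]ffunE.
have [->|->] := two_values _ i hf; have [->|->] := two_values _ i hg => //;
  by rewrite eqxx; move: (base i) => y /eqP; lia.
Qed.

Lemma sum_points_tent_le :
  \sum_(z <- points) \prod_i tent (a i) (b i) (tnth z i) <=
  (\sum_(z <- points) (z \in @dyadic_box R d j m)%:R) / 2 ^+ sumn j.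
Proof.
rewrite mulr_suml; apply: ler_sum => z _.
have [zB|zB] := boolP (z \in _); last first.
  have /existsNP[i ni] : ~ @dyadic_box R d j m z by move: zB; rewrite notin_setE.
  rewrite mul0r (bigD1 i)//= (_ : tent _ _ _ = 0) ?mul0r//.
  apply/eqP/negPn/negP => /tent_gt0/andP[h1 h2]; apply: ni.
  by rewrite /Defs.dyadic_itv/= in_itv/= ltW.
rewrite mul1r sumnE big_tuple expr_sum -prodfV; apply: ler_prod => i _.
rewrite tent_ge0/= -ab; have h : a i <= b i by rewrite -subr_ge0 ab invr_ge0 ltW.
by apply: le_trans (tent_le _ h) _; lra.
Qed.

(** Of the two factors [2 ^- sumn j], one is kept and the other is enlarged to [Q ^- level k j]. *)
Lemma high_volume_le : N%:R * \prod_i ((2 ^+ tnth j i)^-1 ^+ 2 / 4) <=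
  Q ^+ n / Q ^+ level j / 2 ^+ sumn j.
Proof.
apply: (@le_trans _ _ (Q ^+ n * ((2 ^+ sumn j)^-1 ^+ 2))).
  apply: ler_pM => //; first by apply: prodr_ge0 => i _; rewrite divr_ge0 ?sqr_ge0.
    by rewrite -natrX ler_nat card_F.
  rewrite sumnE big_tuple expr_sum -prodfV -prodrXl; apply: ler_prod => i _.
  rewrite divr_ge0 ?sqr_ge0//= ler_pdivrMr// ler_peMr ?sqr_ge0//; lra.
rewrite expr2 !mulrA; apply: ler_pM => //; rewrite ?invr_ge0 ?mulr_ge0 ?invr_ge0 ?exprn_ge0//.
by rewrite ler_pM2l// lef_pV2 ?posrE ?exprn_gt0// level_le.
Qed.

End one_box.

End point_set.

Local Open Scope classical_set_scope.
Local Open Scope ring_scope.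

(** * Haar coefficients of the discrepancy *)

Section product_integral.
Variable R : realType.
Local Notation borelR := (measurableTypeR R).
Local Notation leb := (@lebesgue_measure R).

(** By induction on the first coordinate: Tonelli gives integrability, Fubini the factorisation,
    both transported along [tuple_cons]. *)
Lemma borel_lebesgue_prod d (g : 'I_d -> borelR -> R) :
  (forall i, leb.-integrable setT (EFin \o g i)) ->
  (borel_lebesgue R d).-integrable setT (fun x => (\prod_i g i (tnth x i))%:E) /\
  (\int[borel_lebesgue R d]_x (\prod_i g i (tnth x i))%:E =
   (\prod_i fine (\int[leb]_x (g i x)%:E))%:E)%E.
Proof.
elim: d g => [|d IHd] g gi.
  split.
    apply: (@eq_integrable _ _ _ _ _ _ (cst 1%E)) => //.
      by move=> x _; rewrite big_ord0.
    apply: finite_measure_integrable_cst => //=.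
  rewrite (eq_integral (cst 1%E)); last by move=> x _; rewrite big_ord0.
  by rewrite integral_cst//= big_ord0 mul1e diracT.
have gm i : measurable_fun setT (g i).
  by have /measurable_EFinP := measurable_int _ (gi i).
pose h (t : d.-tuple borelR) := \prod_i g (lift ord0 i) (tnth t i).
have [hi hI] := IHd (fun i => g (lift ord0 i)) (fun i => gi _).
have fE (p : borelR * d.-tuple borelR) : \prod_i g i (tnth (tuple_cons p) i) = g ord0 p.1 * h p.2.
  rewrite big_ord_recl; congr (_ * _); apply: eq_bigr => i _.
  by rewrite tnthS.
pose m1 := leb; pose m2 := borel_lebesgue R d.
have hm : measurable_fun setT h by have /measurable_EFinP := measurable_int _ hi.
pose f (p : borelR * d.-tuple borelR) : \bar R := (g ord0 p.1 * h p.2)%:E.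
have fm : measurable_fun setT f.
  apply/measurable_EFinP; apply: measurable_funM; exact: measurableT_comp.
have fi : (m1 \x m2)%E.-integrable setT f.
  apply/integrable12ltyP => //.
  have habs : measurable_fun setT (fun y => `|h y|%:E).
    by apply/measurable_EFinP; exact: measurableT_comp.
  have gabs : measurable_fun setT (fun x => `|g ord0 x|%:E).
    by apply/measurable_EFinP; exact: measurableT_comp.
  have inner x : (\int[m2]_y `|f (x, y)| = `|g ord0 x|%:E * \int[m2]_y `|h y|%:E)%E.
    rewrite -ge0_integralZl//.
    by apply: eq_integral => y _; rewrite /f/= normrM EFinM.
  rewrite (eq_integral _ _ (fun x _ => inner x)) ge0_integralZr//; last exact: integral_ge0.
  have /integrableP[_ h1] := gi ord0; have /integrableP[_ h2] := hi.
  apply: lte_mul_pinfty => //; first exact: integral_ge0.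
  by rewrite ge0_fin_numE//; exact: integral_ge0.
have fE' : f = (fun x => (\prod_i g i (tnth x i))%:E) \o tuple_cons.
  by apply/funext => p /=; rewrite fE.
have pm : measurable_fun setT (fun x : d.+1.-tuple borelR => (\prod_i g i (tnth x i))%:E).
  apply/measurable_EFinP.
  apply: measurable_prod => i _; apply: measurableT_comp => //; exact: measurable_tnth.
split.
  apply: (@integrable_pushforward _ _ _ _ R tuple_cons (@measurable_tuple_cons R d) (m1 \x m2)%E) => //.
  by rewrite preimage_setT -fE'.
rewrite [LHS](@integral_pushforward _ _ _ _ R tuple_cons (@measurable_tuple_cons R d) (m1 \x m2)%E)//; last first.
  by rewrite preimage_setT -fE'.
rewrite preimage_setT -fE' -integral12_prod_meas1// /fubini_F.
have hfin : (\int[m2]_y (h y)%:E)%E \is a fin_num by apply: integrable_fin_num hi.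
rewrite big_ord_recl EFinM -hI fineK; last by apply: integrable_fin_num (gi _).
have inner x : (\int[m2]_y f (x, y) = (g ord0 x)%:E * \int[m2]_y (h y)%:E)%E.
  rewrite -integralZl//.
rewrite (eq_integral _ _ (fun x _ => inner x)) -(fineK hfin) integralZr//; exact: gi.
Qed.

Lemma lebesgue_tupleE d (A : set (d.-tuple borelR)) :
  measurable A -> lebesgue_tuple R d A = borel_lebesgue R d A.
Proof. by move=> mA; rewrite /lebesgue_tuple /completed_measure_extension measurable_mu_extE. Qed.

Lemma borel_lebesgue_measurable d (A : set (d.-tuple borelR)) :
  measurable A -> lebesgue_measurable A.
Proof. by move=> mA; apply: sub_caratheodory; exact: sub_sigma_algebra. Qed.

(** Seen as a map from the Caratheodory sigma-algebra to the Borel one, the identity pushes the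
    completed measure to the Borel measure; a change of variables then transfers integrals. *)
Lemma lebesgue_tuple_integral d (f : d.-tuple borelR -> \bar R) :
  (borel_lebesgue R d).-integrable setT f ->
  (lebesgue_tuple R d).-integrable setT f /\
  (\int[lebesgue_tuple R d]_x f x = \int[borel_lebesgue R d]_x f x)%E.
Proof.
move=> fi.
pose idm : caratheodory_type ((borel_lebesgue R d)^*)%mu -> d.-tuple borelR := id.
have mid : measurable_fun setT idm.
  by move=> _ A mA; rewrite setTI preimage_id; exact: borel_lebesgue_measurable.
have fm : measurable_fun setT f := measurable_int _ fi.
have [nu nuE] : exists nu : {measure set (d.-tuple borelR) -> \bar R},
    nu = pushforward (lebesgue_tuple R d) idm :> (set _ -> \bar R).
  unshelve eexists [the {measure set _ -> \bar R} of pushforward (lebesgue_tuple R d) idm].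
    exact: mid.
  by [].
have pE (A : set (d.-tuple borelR)) : measurable A -> A `<=` setT ->
    nu A = borel_lebesgue R d A.
  by move=> mA _; rewrite nuE /pushforward preimage_id lebesgue_tupleE.
have fi' : (lebesgue_tuple R d).-integrable setT f.
  apply/integrableP; split.
    by move=> _ B mB; rewrite setTI; apply: borel_lebesgue_measurable; rewrite -[X in measurable X]setTI; exact: fm.
  move/integrableP : fi => [_]; apply: le_lt_trans.
  rewrite -(eq_measure_integral (borel_lebesgue R d) pE) nuE ge0_integral_pushforward//.
  exact: measurableT_comp.
split => //.
rewrite -(eq_measure_integral (borel_lebesgue R d) pE) nuE integral_pushforward//.
Qed.

End product_integral.

(** * One-dimensional integrals of Haar functions *)

Section one_dimensional_integrals.
Variable R : realType.
Local Notation borelR := (measurableTypeR R).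
Local Notation leb := (@lebesgue_measure R).
Implicit Types a b z : R.

Lemma lebesgue_itv_bounded a b x y : a <= b ->
  leb [set` Interval (BSide x a) (BSide y b)] = (b - a)%:E.
Proof.
rewrite lebesgue_measure_itv/= lte_fin le_eqVlt => /orP[/eqP->|->]; last by rewrite EFinB.
by rewrite ltxx subrr.
Qed.

Lemma integral_gt_itv z a b : a <= b ->
  leb.-integrable setT (EFin \o (fun x : borelR => (z < x)%R%:R * \1_([set` `[a, b[]) x)) /\
  (\int[leb]_x ((z < x)%R%:R * \1_([set` `[a, b[]) x)%:E = (Num.max 0 (b - Num.max a z))%:E)%E.
Proof.
move=> ab; have [bz|zb] := leP b z.
  have E x : (z < x)%R%:R * \1_([set` `[a, b[]) x = 0 :> R.
    rewrite indicE; case: ltP => zx; last by rewrite mul0r.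
    by rewrite memNset ?mulr0//= in_itv/= => /andP[_]; rewrite ltNge (le_trans bz)// ltW.
  split; first by apply: (eq_integrable _ (cst 0%E)) (integrable0 _ _) => // x _; rewrite /= E.
  have m0 : b - Num.max a z <= 0 by rewrite subr_le0 le_max bz orbT.
  by rewrite integral0_eq ?(max_l m0)// => x _; rewrite E.
(* The condition [z < x] moves the left end to [Num.max a z]; [s] records whether that end is
   closed. *)
have [s E] : exists s, (fun x : borelR => (z < x)%R%:R * \1_([set` `[a, b[]) x) =
    \1_[set` Interval (BSide s (Num.max a z)) (BSide true b)] :> (borelR -> R).
  have [za|az] := ltP z a.
    exists true; apply/funext => x; rewrite !indicE.
    case: (boolP (x \in _)) => [|_]; last by rewrite mulr0.
    by rewrite inE/= in_itv/= => /andP[ax _]; rewrite (lt_le_trans za ax) mul1r.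
  exists false; apply/funext => x; rewrite !indicE; case: ltP => zx.
    rewrite mul1r; congr (nat_of_bool _)%:R; apply/idP/idP; rewrite !inE/= !in_itv/= zx.
      by move=> /andP[].
    by move=> /= ->; rewrite (le_trans az (ltW zx)).
  rewrite mul0r memNset//= in_itv/= => /andP[]; by rewrite ltNge zx.
have azb : Num.max a z <= b by rewrite ge_max ab ltW.
split; first by rewrite E; exact: integrable_indic_itv.
rewrite (eq_integral (fun x : borelR => (\1_[set` Interval (BSide s (Num.max a z)) (BSide true b)] x)%:E)); last first.
  by move=> x _; have /= -> := congr1 (@^~ x) E.
have m0 : 0 <= b - Num.max a z by rewrite subr_ge0.
by rewrite integral_indic//= setIT lebesgue_itv_bounded// (max_r m0).
Qed.

Lemma integral_id_itv a b : a <= b ->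
  leb.-integrable setT (EFin \o (fun x : borelR => x * \1_([set` `[a, b[]) x)) /\
  (\int[leb]_x (x * \1_([set` `[a, b[]) x)%:E = ((b ^+ 2 - a ^+ 2) / 2)%:E)%E.
Proof.
rewrite le_eqVlt => /orP[/eqP->|ab].
  rewrite set_itv_ge ?bnd_simp ?ltxx// indic0.
  split; first by apply: (eq_integrable _ (cst 0%E)) (integrable0 _ _) => // x _; rewrite /= mulr0.
  by rewrite integral0_eq ?subrr ?mul0r// => x _; rewrite mulr0.
have E : (fun x : borelR => (x * \1_([set` `[a, b[]) x)%:E) = (fun x => x%:E) \_ ([set` `[a, b[]).
  apply/funext => x; rewrite /patch indicE; case: ifPn => _; by rewrite ?mulr1 ?mulr0.
have ci : leb.-integrable [set` `[a, b]] (fun x : borelR => x%:E).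
  apply: (@continuous_compact_integrable R id); first exact: segment_compact.
  by apply: continuous_subspaceT => x; exact: cvg_id.
have hi : leb.-integrable [set` `[a, b[] (fun x : borelR => x%:E).
  by apply: integrableS ci => //= x /=; rewrite !in_itv/= => /andP[-> /ltW->].
split; first by rewrite [X in integrable _ _ X]E -integrable_mkcond.
rewrite E -integral_mkcond.
rewrite integral_itv_bndo_bndc; last exact: measurable_int hi.
rewrite (@continuous_FTC2 R id (fun x => x ^+ 2 / 2))// ?mulrBl ?EFinB//.
- by apply: continuous_subspaceT => x; exact: cvg_id.
- have cF (x : R) : {for x, continuous (fun x : R => x ^+ 2 / 2)}.
    by apply: continuousM; [exact: exprn_continuous|exact: cst_continuous].
  split; first by move=> x _; exact: ex_derive.
    exact/cvg_at_right_filter/cF.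
  exact/cvg_at_left_filter/cF.
- move=> x _; rewrite derive1E derive_val scaler0 scaler0 add0r.
  by rewrite /GRing.scale/= mulr1; field.
Qed.


Lemma haar1_split (j m : nat) (x : R) :
  let a : R := m%:R / 2 ^+ j in let b : R := m.+1%:R / 2 ^+ j in
  haar1 j m x = \1_([set` `[a, (a + b) / 2[]) x - \1_([set` `[(a + b) / 2, b[]) x.
Proof.
move=> a b; rewrite /haar1 /Defs.dyadic_itv.
have p0 : (2 : R) ^+ j != 0 by rewrite expf_neq0.
have e1 : m.*2%:R / 2 ^+ j.+1 = a :> R.
  by rewrite /a exprS -muln2 natrM; field.
have e2 : m.*2.+1%:R / 2 ^+ j.+1 = (a + b) / 2 :> R.
  by rewrite /a /b exprS -muln2 -!natr1 natrM; field.
have e3 : m.*2.+2%:R / 2 ^+ j.+1 = b :> R.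
  by rewrite /b exprS -muln2 -!natr1 natrM; field.
by rewrite e1 e2 e3.
Qed.

(** This is how tents arise from the counting part. The total integral is 0 and the negative half
    lies on the right, so the mass beyond [z] is minus the primitive. *)
Lemma integral_haar1_gt (j m : nat) z :
  leb.-integrable setT (EFin \o (fun x : borelR => (z < x)%R%:R * haar1 j m x)) /\
  (\int[leb]_x ((z < x)%R%:R * haar1 j m x)%:E =
    (- tent (m%:R / 2 ^+ j) (m.+1%:R / 2 ^+ j) z)%:E)%E.
Proof.
set a : R := m%:R / _; set b : R := m.+1%:R / _.
have ab : a < b by rewrite ltr_pM2r ?invr_gt0 ?exprn_gt0// ltr_nat.
have ac : a <= (a + b) / 2 by lra.
have cb : (a + b) / 2 <= b by lra.
have [i1 I1] := integral_gt_itv z ac; have [i2 I2] := integral_gt_itv z cb.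
have E (x : borelR) : ((z < x)%R%:R * haar1 j m x)%:E =
    (((z < x)%R%:R * \1_([set` `[a, (a + b) / 2[]) x)%:E -
    ((z < x)%R%:R * \1_([set` `[(a + b) / 2, b[]) x)%:E)%E.
  by rewrite haar1_split mulrBr EFinB.
split; first by apply: (eq_integrable measurableT _ _) (integrableB measurableT i1 i2) => // x _; rewrite /= E.
rewrite (eq_integral _ _ (fun x _ => E x)) integralB//= I1 I2 -EFinB; congr EFin.
case: (leP a z) => az; case: (leP ((a + b) / 2) z) => cz;
  case: (leP 0 (_ / 2 - _)) => h1; case: (leP 0 (b - _)) => h2; case: tentP => *; lra.
Qed.

Lemma integral_haar1_id (j m : nat) :
  leb.-integrable setT (EFin \o (fun x : borelR => x * haar1 j m x)) /\
  (\int[leb]_x (x * haar1 j m x)%:E = (- ((2 ^+ j)^-1 ^+ 2 / 4))%:E)%E.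
Proof.
set a : R := m%:R / 2 ^+ j; set b : R := m.+1%:R / 2 ^+ j.
have ab : a < b by rewrite ltr_pM2r ?invr_gt0 ?exprn_gt0// ltr_nat.
have ac : a <= (a + b) / 2 by lra.
have cb : (a + b) / 2 <= b by lra.
have [i1 I1] := integral_id_itv ac; have [i2 I2] := integral_id_itv cb.
have E (x : borelR) : (x * haar1 j m x)%:E =
    ((x * \1_([set` `[a, (a + b) / 2[]) x)%:E - (x * \1_([set` `[(a + b) / 2, b[]) x)%:E)%E.
  by rewrite haar1_split mulrBr EFinB.
split; first by apply: (eq_integrable measurableT _ _) (integrableB measurableT i1 i2) => // x _; rewrite /= E.
rewrite (eq_integral _ _ (fun x _ => E x)) integralB//= I1 I2 -EFinB; congr EFin.
have -> : (2 ^+ j)^-1 = b - a by rewrite /a /b -mulrBl -natrB// subSnn mul1r.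
by field.
Qed.

End one_dimensional_integrals.

Section haar_coefficients.
Variables (R : realType) (d : nat).
Local Notation borelR := (measurableTypeR R).
Local Notation leb := (@lebesgue_measure R).
Implicit Types (j m : d.-tuple nat) (P : {fset d.-tuple R}).

Lemma sumn_tuple (j : d.-tuple nat) : sumn j = (\sum_(i < d) tnth j i)%N.
Proof. by rewrite sumnE big_tuple. Qed.

Lemma dyadic_itv_ub (j m : nat) (t : R) : (m < 2 ^ j)%N -> Defs.dyadic_itv j m t -> 0 <= t < 1.
Proof.
move=> mj; rewrite /Defs.dyadic_itv/= in_itv/= => /andP[h1 h2]; apply/andP; split.
  by apply: le_trans h1; rewrite divr_ge0// exprn_ge0.
apply: lt_le_trans h2 _; rewrite ler_pdivrMr ?exprn_gt0// mul1r.
by rewrite -natrX ler_nat.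
Qed.

Lemma haar1_out (j m : nat) (t : R) : (m < 2 ^ j)%N -> ~~ (0 <= t < 1) -> haar1 j m t = 0.
Proof.
move=> mj nt; have mj1 : (m.*2.+1 < 2 ^ j.+1)%N by rewrite expnS mul2n; lia.
rewrite /haar1 !indicE !memNset ?subrr// => /dyadic_itv_ub.
  by move=> /(_ mj1); exact/negP.
by move=> /(_ (ltnW mj1)); exact/negP.
Qed.

Lemma dyadic_box_measurable j m : measurable (@dyadic_box R d j m : set (d.-tuple borelR)).
Proof.
have -> : (@dyadic_box R d j m : set (d.-tuple borelR)) =
    \bigcap_(i in [set: 'I_d]) ((fun x : d.-tuple borelR => tnth x i) @^-1`
       (Defs.dyadic_itv (tnth j i) (tnth m i))).
  apply/seteqP; split => x /= h; first by move=> i _; exact: h.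
  by move=> i; exact: h.
apply: fin_bigcap_measurable => // i _; rewrite -[X in measurable X]setTI.
apply: (measurable_tnth (T := borelR) i) => //.
exact: measurable_itv.
Qed.

Lemma dyadic_box_measure j m :
  lebesgue_tuple R d (dyadic_box j m) = ((2 ^+ sumn j)^-1)%:E.
Proof.
have mB := @dyadic_box_measurable j m.
rewrite lebesgue_tupleE//.
pose g i (x : borelR) : R := \1_(Defs.dyadic_itv (tnth j i) (tnth m i)) x.
have gi i : leb.-integrable setT (EFin \o g i) by exact: integrable_indic_itv.
have [_ I] := borel_lebesgue_prod gi.
have := integral_indic (borel_lebesgue R d) measurableT mB; rewrite setIT => <-.
rewrite -[LHS](_ : (\int[borel_lebesgue R d]_x (\prod_i g i (tnth x i))%:E)%E = _); last first.
  apply: eq_integral => x _; congr EFin; rewrite /g indicE.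
  have [xB|xB] := boolP (x \in dyadic_box j m).
    by rewrite big1// => i _; rewrite indicE mem_set//; move: xB; rewrite inE; exact.
  have /existsNP[i ni] : ~ dyadic_box j m x by move: xB; rewrite notin_setE.
  by rewrite (bigD1 i)//= indicE memNset// mul0r.
rewrite I; congr EFin; rewrite sumn_tuple expr_sum -prodfV; apply: eq_bigr => i _.
rewrite /g integral_indic ?setIT; [|exact: measurableT|exact: measurable_itv].
have le_m : (tnth m i)%:R / 2 ^+ tnth j i <= (tnth m i).+1%:R / 2 ^+ tnth j i :> R.
  by rewrite ler_pM2r ?invr_gt0 ?exprn_gt0// ler_nat.
rewrite [X in fine X](lebesgue_itv_bounded true true le_m)/=.
by rewrite -mulrBl -natrB// subSnn mul1r.
Qed.

(** Both the counting part and the volume part factor over the coordinates, and each factor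
    contributes a sign. *)
Lemma inner_discrepancy P j m : (forall z, z \in P -> unit_cube z) -> dyadic_index j m ->
  inner (discrepancy P) (haar j m) = (-1) ^+ d *
    (\sum_(z <- P) \prod_i tent ((tnth m i)%:R / 2 ^+ tnth j i)
                              ((tnth m i).+1%:R / 2 ^+ tnth j i) (tnth z i) -
     #|` P|%:R * \prod_i ((2 ^+ tnth j i)^-1 ^+ 2 / 4)).
Proof.
move=> Pc mj.
pose g z i (x : borelR) : R := (tnth z i < x)%R%:R * haar1 (tnth j i) (tnth m i) x.
pose k i (x : borelR) : R := x * haar1 (tnth j i) (tnth m i) x.
have gi z i : leb.-integrable setT (EFin \o g z i) := (integral_haar1_gt _ _ _).1.
have ki i : leb.-integrable setT (EFin \o k i) := (integral_haar1_id _ _ _).1.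
pose G z (x : d.-tuple borelR) : \bar R := (\prod_i g z i (tnth x i))%:E.
pose K (x : d.-tuple borelR) : \bar R := (\prod_i k i (tnth x i))%:E.
have GI (z : d.-tuple R) := borel_lebesgue_prod (gi z); have KI := borel_lebesgue_prod ki.
have Gi z : (borel_lebesgue R d).-integrable setT (G z) by case: (GI z).
have Ki : (borel_lebesgue R d).-integrable setT K by case: KI.
have KNi : (borel_lebesgue R d).-integrable setT (fun x => #|` P|%:R%:E * K x)%E.
  exact: integrableZl.
have Si : (borel_lebesgue R d).-integrable setT (fun x => \sum_(z <- P) G z x)%E.
  exact: integrable_sum.
pose H (x : d.-tuple borelR) := (\sum_(z <- P) G z x - #|` P|%:R%:E * K x)%E.
have Hi : (borel_lebesgue R d).-integrable setT H by exact: integrableB.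
have [_ HE] := lebesgue_tuple_integral Hi.
rewrite /inner /Rintegral integral_mkcond.
rewrite (_ : (_ \_ _) = H); last first.
  apply/funext => x; rewrite /patch; have [xC|xC] := ifPn; last first.
    have /existsNP[i ni] : ~ @unit_cube R d x by move: xC; rewrite notin_setE.
    have h0 : haar1 (tnth j i) (tnth m i) (tnth x i) = 0.
      by apply: haar1_out; [exact: mj|apply/negP; move: ni; rewrite in_itv].
    have K0 : K x = 0%E by rewrite /K (bigD1 i)//= {1}/k h0 mulr0 mul0r.
    have G0 z : G z x = 0%E by rewrite /G (bigD1 i)//= {1}/g h0 mulr0 mul0r.
    by rewrite /H K0 mule0 big1 ?sube0.
  move: xC; rewrite inE => xC.
  rewrite /H /K -EFinM sumEFin -EFinB; congr EFin.
  rewrite /discrepancy mulrBl mulr_suml; congr (_ - _).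
    (* Points of [P] have nonnegative coordinates, so only the strict upper bounds decide membership
       in the anchored box. *)
    apply: eq_big_seq => z /Pc zC; rewrite /haar big_split/=; congr (_ * _).
    rewrite indicE; have [zx|zx] := boolP (z \in anchored_box x).
      rewrite big1// => i _; move: zx; rewrite inE => /(_ i); rewrite in_itv/= => /andP[_ ->//].
    have /existsNP[i ni] : ~ anchored_box x z by move: zx; rewrite notin_setE.
    rewrite (bigD1 i)//= (_ : (_ < _)%R = false) ?mul0r//.
    apply/negP => lt_zx; apply: ni; rewrite in_itv/= lt_zx andbT.
    by have := zC i; rewrite in_itv => /andP[].
  by rewrite -mulrA /haar -big_split.
rewrite HE integralB// integral_sum// integralZl//.
rewrite (eq_bigr (fun z => (\prod_i fine (\int[leb]_x (g z i x)%:E))%:E)%E); last first.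
  by move=> z _; case: (GI z).
have [_ ->] := KI; rewrite sumEFin -EFinM -EFinB/= mulrBr mulr_sumr; congr (_ - _).
  apply: eq_bigr => z _; rewrite -[d in _ ^+ d]card_ord -prodr_const -big_split/=.
  by apply: eq_bigr => i _; rewrite (integral_haar1_gt _ _ _).2/= mulN1r.
rewrite mulrCA; congr (_ * _); rewrite -[d in _ ^+ d]card_ord -prodr_const -big_split/=.
by apply: eq_bigr => i _; rewrite (integral_haar1_id _ _ _).2/= mulN1r.
Qed.

End haar_coefficients.

(** * Boxes below the scale of the net *)

Lemma uniq_size_inj (A : eqType) (B : finType) (s : seq A) (g : A -> B) :
  uniq s -> {in s &, injective g} -> (size s <= #|B|)%N.
Proof.
move=> us gi; have ug : uniq (map g s) by rewrite map_inj_in_uniq.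
by rewrite -(size_map g) -(card_uniqP ug) max_card.
Qed.

Lemma sum_lift_inj m (a b : 'I_m.+1 -> nat) :
  (\sum_i a i = \sum_i b i)%N -> (forall i, a (lift ord0 i) = b (lift ord0 i)) -> forall i, a i = b i.
Proof.
rewrite !big_ord_recl => E ab i; have [j ->|->] := unliftP ord0 i; first exact: ab.
by move: E; under eq_bigr do rewrite ab; move/addIn.
Qed.

Section level_counts.
Variables (dm k : nat).
Hypothesis k_gt0 : (0 < k)%N.
Local Notation d := dm.+1.

(** A level vector is determined by its residues modulo [k.*2] and its depths. The sum of the depths
    is fixed, so all but one of them suffice; this is the source of the exponent [d - 1]. *)
Lemma count_level (s : seq (d.-tuple nat)) tau : uniq s ->
  (forall j, j \in s -> level k j = tau) -> (size s <= (k.*2) ^ d * tau.+1 ^ dm)%N.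
Proof.
move=> us sl.
have k2 : (0 < k.*2)%N by rewrite double_gt0.
pose g (j : d.-tuple nat) : {ffun 'I_d -> 'I_(k.*2)} * {ffun 'I_dm -> 'I_tau.+1} :=
  ([ffun i => Ordinal (ltn_pmod (tnth j i) k2)], [ffun i => inord (depth k j (lift ord0 i))]).
have -> : (k.*2 ^ d * tau.+1 ^ dm)%N = #|{: {ffun 'I_d -> 'I_(k.*2)} * {ffun 'I_dm -> 'I_tau.+1}}|.
  by rewrite card_prod !card_ffun !card_ord.
apply: (uniq_size_inj (g := g)) => // j l js ls [/ffunP e1 /ffunP e2].
have dl (h : d.-tuple nat) i : h \in s -> (depth k h i < tau.+1)%N.
  move=> /sl <-; rewrite ltnS /level (bigD1 i)//= -addnn -addnA leq_addr//.
have ej : forall i, depth k j i = depth k l i.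
  apply: sum_lift_inj.
    have := sl _ js; rewrite -(sl _ ls) /level -!(big_morph _ doubleD double0).
    exact: double_inj.
  move=> i'; have := e2 i'; rewrite !ffunE => /(congr1 val)/=.
  by rewrite !inordK ?dl// => ->.
apply: eq_from_tnth => i; rewrite (divn_eq (tnth j i) k.*2) (divn_eq (tnth l i) k.*2).
have /(congr1 val)/= := e1 i; rewrite !ffunE/= => ->.
by have := ej i; rewrite /depth => ->.
Qed.

Lemma count_sum_eq s : (#|[set a : {ffun 'I_d -> 'I_s.+1} | (\sum_i (a i : nat))%N == s]| <= s.+1 ^ dm)%N.
Proof.
have -> : (s.+1 ^ dm)%N = #|{: {ffun 'I_dm -> 'I_s.+1}}| by rewrite card_ffun !card_ord.
apply: (@leq_card_in _ _ (fun a : {ffun 'I_d -> 'I_s.+1} => [ffun i : 'I_dm => a (lift ord0 i)])).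
move=> a b; rewrite !inE => /eqP sa /eqP sb /ffunP ab; apply/ffunP => i; apply: val_inj.
have E : (\sum_i (a i : nat) = \sum_i (b i : nat))%N by rewrite sa sb.
apply: (sum_lift_inj E).
by move=> i'; have := ab i'; rewrite !ffunE => ->.
Qed.

Lemma exists_sum_eq (a : 'I_d -> nat) s : (s <= \sum_i a i)%N ->
  exists b : {ffun 'I_d -> 'I_s.+1}, (\sum_i (b i : nat))%N = s /\ forall i, (b i <= a i)%N.
Proof.
move=> sa; suff [b [sb ba]] : exists b : 'I_d -> nat, (\sum_i b i)%N = s /\ forall i, (b i <= a i)%N.
  have bs i : (b i < s.+1)%N by rewrite ltnS -sb (bigD1 i)//= leq_addr.
  exists [ffun i => Ordinal (bs i)]; split; last by move=> i; rewrite ffunE/= ba.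
  by rewrite -[RHS]sb; apply: eq_bigr => i _; rewrite ffunE.
elim: {sa}_.+1 {-2}s (ltnSn s) sa => // m IHm [|u] um su.
  by exists (fun=> 0%N); split => //; rewrite big1.
have [b [sb ba]] := IHm u um (ltnW su).
have [i bi] : exists i, (b i < a i)%N.
  apply/existsP; rewrite -[X in is_true X]negbK negb_exists; apply/negP => /forallP h.
  move: su; rewrite -sb ltnNge => /negP; apply; apply: leq_sum => i _.
  by rewrite leqNgt h.
exists (fun l => b l + (l == i))%N; split.
  rewrite big_split/= sb (bigD1 i)//= eqxx big1 ?addn0 ?addn1// => l /negbTE -> //.
move=> l; case: eqP => [->|_]; first by rewrite addn1.
by rewrite addn0.
Qed.

End level_counts.

(** * Dyadic cells and twin boxes *)

Section cells.
Variables (R : realType) (d : nat).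
Implicit Types (t : R) (z x p : d.-tuple R) (j m : d.-tuple nat).

Definition bin (j : nat) t : nat := Num.truncn (t * 2 ^+ j).

Lemma dyadic_itvP (j m : nat) t : 0 <= t -> Defs.dyadic_itv j m t <-> bin j t = m.
Proof.
move=> t0; have p0 : 0 < 2 ^+ j :> R by rewrite exprn_gt0.
rewrite /Defs.dyadic_itv/= in_itv/= ler_pdivrMr// ltr_pdivlMr//.
split => [h|<-]; last by apply: truncn_itv; rewrite mulr_ge0// ltW.
exact: truncn_def.
Qed.

Lemma bin_lt (j : nat) t : 0 <= t < 1 -> (bin j t < 2 ^ j)%N.
Proof.
move=> /andP[t0 t1]; rewrite -(ltr_nat R).
have p0 : 0 < 2 ^+ j :> R by rewrite exprn_gt0.
have /andP[h _] := truncn_itv (mulr_ge0 t0 (ltW p0)).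
by apply: le_lt_trans h _; rewrite natrX gtr_pMl.
Qed.

Lemma bin_div (j l : nat) t : 0 <= t -> (bin (j + l) t %/ 2 ^ l)%N = bin j t.
Proof.
move=> t0; apply/esym/dyadic_itvP => //.
have /dyadic_itvP-/(_ t0) := erefl (bin (j + l) t).
rewrite /Defs.dyadic_itv/= !in_itv/=; set b := bin _ _ => /andP[h1 h2].
have p0 i : 0 < 2 ^+ i :> R by rewrite exprn_gt0.
move: h1 h2; rewrite !ler_pdivrMr// !ltr_pdivlMr// exprD mulrA => h1 h2.
apply/andP; split.
  rewrite -(ler_pM2r (p0 l)); apply: le_trans h1.
  by rewrite -natrX -natrM ler_nat leq_divM.
rewrite -(ltr_pM2r (p0 l)); apply: lt_le_trans h2 _.
by rewrite -natrX -natrM ler_nat ltn_ceil// expn_gt0.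
Qed.

Lemma eq_bin (j l : nat) t u : 0 <= t -> 0 <= u -> (j <= l)%N -> bin l t = bin l u -> bin j t = bin j u.
Proof.
by move=> t0 u0 /subnKC <- E; rewrite -(bin_div _ (l - j) t0) -(bin_div _ (l - j) u0) E.
Qed.

Definition cell j z : d.-tuple nat := [tuple bin (tnth j i) (tnth z i) | i < d].

Lemma dyadic_boxP j m z : unit_cube z -> dyadic_box j m z <-> cell j z = m.
Proof.
move=> zC; have z0 i : 0 <= tnth z i by have := zC i; rewrite in_itv/= => /andP[].
split => [h|<- i]; last by apply/dyadic_itvP => //; rewrite tnth_mktuple.
apply: eq_from_tnth => i; rewrite tnth_mktuple; exact/dyadic_itvP.
Qed.

Lemma cell_index j z : unit_cube z -> dyadic_index j (cell j z).
Proof.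
by move=> zC i; rewrite tnth_mktuple bin_lt//; have := zC i; rewrite in_itv.
Qed.

Definition flip (a : nat) : nat := if odd a then a.-1 else a.+1.

Definition refine j : d.-tuple nat := [tuple (tnth j i).+1 | i < d].

(* In each coordinate, the half of the interval of level [j] around [p] which
   does not contain [p]. *)
Definition twin j p : set (d.-tuple R) :=
  dyadic_box (refine j) [tuple flip (bin (tnth j i).+1 (tnth p i)) | i < d].

Lemma sumn_refine j : sumn (refine j) = (sumn j + d)%N.
Proof.
rewrite !sumnE !big_tuple (eq_bigr (fun i => tnth j i + 1)%N); last first.
  by move=> i _; rewrite tnth_mktuple addn1.
by rewrite big_split/= sum1_card card_ord.
Qed.

Lemma twinP j p x : unit_cube p -> unit_cube x -> twin j p x ->
  forall i, bin (tnth j i) (tnth x i) = bin (tnth j i) (tnth p i) /\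
    bin (tnth j i).+1 (tnth x i) <> bin (tnth j i).+1 (tnth p i).
Proof.
move=> pC xC tx i.
have z0 (z : d.-tuple R) : unit_cube z -> 0 <= tnth z i by move=> /(_ i); rewrite in_itv/= => /andP[].
have := tx i; rewrite !tnth_mktuple => /(dyadic_itvP _ _ (z0 _ xC)) E.
have h z : unit_cube z -> bin (tnth j i) (tnth z i) = (bin (tnth j i).+1 (tnth z i))./2.
  by move=> zC; rewrite -(bin_div _ 1 (z0 _ zC)) addn1 expn1 divn2.
rewrite !h// E /flip; move: (bin _ _) => b; case: ifP => ob; split; try lia.
Qed.

Lemma twin_sub j p : unit_cube p -> twin j p `<=` dyadic_box j (cell j p).
Proof.
move=> pC x tx; have mj : dyadic_index (refine j) [tuple flip (bin (tnth j i).+1 (tnth p i)) | i < d].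
  move=> i; rewrite !tnth_mktuple.
  have : (bin (tnth j i).+1 (tnth p i) < 2 ^ (tnth j i).+1)%N.
    by apply: bin_lt; have := pC i; rewrite in_itv.
  rewrite /flip expnS mul2n; move: (bin _ _) => b; case: ifP => ob; lia.
have xC : unit_cube x.
  by move=> i; rewrite in_itv/=; apply: dyadic_itv_ub (mj i) (tx i).
apply/dyadic_boxP => //; apply: eq_from_tnth => i; rewrite !tnth_mktuple.
by have [] := twinP pC xC tx i.
Qed.

(** Entry [i] of the level is the last scale at which coordinates [i] of [p] and [x] lie in the same
    dyadic interval. *)
Lemma twin_uniq j l p x : unit_cube p -> unit_cube x -> twin j p x -> twin l p x -> j = l.
Proof.
move=> pC xC jx lx; apply: eq_from_tnth => i.
have z0 (z : d.-tuple R) : unit_cube z -> 0 <= tnth z i by move=> /(_ i); rewrite in_itv/= => /andP[].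
have [j1 j2] := twinP pC xC jx i; have [l1 l2] := twinP pC xC lx i.
by case: (ltngtP (tnth j i) (tnth l i)) => // h;
  [case: j2|case: l2]; apply: eq_bin h _ => //; exact: z0.
Qed.

End cells.

Section overlap.
Variables (R : realType) (F : finFieldType) (dm k n N : nat).
Local Notation d := dm.+1.
Variable alpha : 'I_d * bool -> F.
Hypotheses (alpha_inj : injective alpha) (k_gt1 : (1 < k)%N) (card_F : #|F| = (2 ^ k)%N).
Hypotheses (N_gt : ((2 ^ k) ^ n.-1 < N)%N) (N_le : (N <= (2 ^ k) ^ n)%N).
Local Notation points := (points R n N alpha).
Local Notation s := (uphalf n).

Let points_cube z : z \in points -> @unit_cube R d z.
Proof. by move=> zP; exact: (points_in_cube card_F N_gt N_le zP). Qed.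

Lemma sum_points_box (j m : d.-tuple nat) : dyadic_index j m -> (n <= level k j)%N ->
  (\sum_(z <- points) (z \in @dyadic_box R d j m) <= 2 ^ d)%N.
Proof.
move=> jm nl; rewrite -(@ler_nat R) natr_sum.
rewrite (sum_points (R := R) alpha_inj k_gt1 card_F N_gt N_le (fun z => (z \in dyadic_box j m)%:R)) big_mkcond/=.
apply: (@le_trans _ _ (\sum_f (point R N alpha f \in dyadic_box j m)%:R)).
  by apply: ler_sum => f _; case: ifP.
rewrite natr_card_set ler_nat; exact: (card_points_box R alpha_inj k_gt1 card_F N_gt N_le m nl).
Qed.

(** Representatives with depths exactly [a]. When the depths add up to [s], the level is [s.*2],
    that is [n] or [n.+1], so [sum_points_box] applies. *)
Let grid (a : {ffun 'I_d -> 'I_s.+1}) : d.-tuple nat := [tuple (a i * k.*2)%N | i < d].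

Let depth_grid a i : depth k (grid a) i = a i.
Proof. by rewrite /depth tnth_mktuple mulnK// double_gt0 ltnW. Qed.

Let near (x z : d.-tuple R) : bool :=
  [exists a : {ffun 'I_d -> 'I_s.+1}, ((\sum_i (a i : nat))%N == s) && (cell (grid a) z == cell (grid a) x)].

(** There are at most [s.+1 ^ dm] choices of [a], and each box holds at most [2 ^ d] points. *)
Lemma sum_near x : unit_cube x -> (\sum_(z <- points) near x z <= 2 ^ d * s.+1 ^ dm)%N.
Proof.
move=> xC; apply: (@leq_trans (\sum_(z <- points) \sum_(a : {ffun 'I_d -> 'I_s.+1} | (\sum_i (a i : nat))%N == s)
    (z \in @dyadic_box R d (grid a) (cell (grid a) x)))%N).
  rewrite big_seq [leqRHS]big_seq; apply: leq_sum => z zP.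
  case: (boolP (near x z)) => // /existsP[a /andP[sa /eqP ca]].
  rewrite (bigD1 a)//= mem_set ?leq_addr//.
  by apply/dyadic_boxP => //; exact: points_cube.
rewrite exchange_big/=; apply: (@leq_trans (\sum_(a : {ffun 'I_d -> 'I_s.+1} | (\sum_i (a i : nat))%N == s) 2 ^ d)%N).
  apply: leq_sum => a /eqP sa; apply: sum_points_box; first exact: cell_index.
  rewrite /level (eq_bigr (fun i => (a i).*2)); last by move=> i _; rewrite depth_grid.
  rewrite -(big_morph _ doubleD double0) sa uphalf_half.
  by rewrite -[leqLHS]odd_double_half doubleD leq_add2r; case: (odd n).
rewrite sum_nat_const mulnC leq_mul2l; apply/orP; right.
by apply: leq_trans (count_sum_eq dm s); apply: subset_leq_card; apply/fintype.subsetP => a; rewrite !inE.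
Qed.

(** For a fixed point [z] at most one twin contains [x]. If there is one, its box has depths of sum
    at least [s], so it sits inside a grid box shared by [x] and [z], and [z] is near [x]. *)
Lemma overlap_le (X : seq (d.-tuple nat)) x : uniq X -> unit_cube x ->
  (\sum_(j <- X | (n < level k j)%N) \sum_(z <- points) (x \in twin j z) <= 2 ^ d * s.+1 ^ dm)%N.
Proof.
move=> uX xC; rewrite exchange_big/=; apply: leq_trans (sum_near xC).
rewrite big_seq [leqRHS]big_seq; apply: leq_sum => z /points_cube zC.
have -> : (\sum_(j <- X | (n < level k j)%N) (x \in twin j z))%N =
    size [seq j <- X | (n < level k j)%N && (x \in twin j z)].
  by rewrite size_filter -sum1_count [RHS]big_mkcondr; apply: eq_bigr => j _; case: (x \in _).
set Y := [seq j <- X | _].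
have Y1 : (size Y <= 1)%N.
  rewrite -card_unit; apply: (uniq_size_inj (g := fun=> tt)); first exact: filter_uniq.
  move=> j l; rewrite !mem_filter => /andP[/andP[_ /set_mem jx] _] /andP[/andP[_ /set_mem lx] _] _.
  exact: twin_uniq jx lx.
case EY : Y Y1 => [|j [|//]] //= _.
have : j \in Y by rewrite EY mem_head.
rewrite mem_filter => /andP[/andP[nj /set_mem jx] _].
have [a [sa aj]] : exists b : {ffun 'I_d -> 'I_s.+1}, (\sum_i (b i : nat))%N = s /\ forall i, (b i <= depth k j i)%N.
  apply: exists_sum_eq; move: nj; rewrite /level -(big_morph _ doubleD double0) uphalf_half.
  rewrite -{1}(odd_double_half n); move: (\sum_(i < d) _)%N => u; case: (odd n); lia.
rewrite (_ : near x z)//; apply/existsP; exists a; rewrite sa eqxx/=; apply/eqP.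
apply: eq_from_tnth => i; rewrite !tnth_mktuple.
have [e _] := twinP zC xC jx i; apply/esym; apply: eq_bin e.
- by have := xC i; rewrite in_itv/= => /andP[].
- by have := zC i; rewrite in_itv/= => /andP[].
- by apply: leq_trans (leq_divM (tnth j i) k.*2); rewrite leq_mul2r aj orbT.
Qed.

End overlap.

(** * The BMO estimate *)

(** Integrate the covering multiplicity over [U]. *)
Lemma measure_overlap (R : realType) dd (T : measurableType dd)
    (mu : {measure set T -> \bar R}) (U : set T) (I : Type) (s : seq I)
    (Q : I -> set T) (P : pred I) (H : R) :
  measurable U -> (forall i, measurable (Q i)) -> (forall i, P i -> Q i `<=` U) ->
  (forall x, U x -> \sum_(i <- s | P i) (x \in Q i)%:R <= H) ->
  (\sum_(i <- s | P i) mu (Q i) <= H%:E * mu U)%E.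
Proof.
move=> mU mQ QU QH.
rewrite -integral_cst//.
rewrite (eq_bigr (fun i => (\int[mu]_(x in U) (\1_(Q i) x)%:E)%E)); last first.
  by move=> i Pi; rewrite integral_indic// setIidl//; exact: QU.
have mI i : measurable_fun U (fun x => (\1_(Q i) x : R)%:E).
  by apply/measurable_EFinP; apply: measurable_funTS; exact: measurable_indic.
rewrite -big_filter -ge0_integral_sum//.
apply: ge0_le_integral => //.
- by move=> x _; apply: sume_ge0 => i _; rewrite lee_fin.
- by apply: emeasurable_sum.
- move=> x Ux; rewrite /= sumEFin lee_fin big_filter.
  by apply: le_trans (QH x Ux); apply: ler_sum => i _; rewrite indicE.
Qed.

Lemma esum_le_seq (R : realType) (T : choiceType) (S : set T) (a : T -> R) (B : R) :
  (forall Y : seq T, uniq Y -> (forall y, y \in Y -> S y) -> \sum_(y <- Y) a y <= B) ->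
  (\esum_(y in S) (a y)%:E <= B%:E)%E.
Proof.
move=> h; apply: ub_ereal_sup => _ [A [finA AS] <-].
rewrite fsbig_finite//= sumEFin lee_fin; apply: h; first exact: fset_uniq.
by move=> y; rewrite in_fset_set// inE => /AS.
Qed.

(** With truncated subtraction the exponent is the distance from [t] to [n], and each side is a
    geometric series of sum at most 2. *)
Lemma sum_pow_dist (R : realFieldType) (n M : nat) :
  \sum_(t < M) (2^-1 : R) ^+ ((n - t) + (t - n)) <= 4.
Proof.
have half0 m : 0 <= (2^-1 : R) ^+ m by rewrite exprn_ge0 ?invr_ge0.
suff : \sum_(t < M) (2^-1 : R) ^+ ((n - t) + (t - n)) <= 2 + \sum_(i < n) (2^-1 : R) ^+ i.
  by move=> h; apply: le_trans h _; have := sum_pow_half R n; lra.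
elim: n M => [|n IHn] [|M]; rewrite ?big_ord0 ?addr0//.
- apply: le_trans (sum_pow_half R M.+1); apply: ler_sum => t _.
  by rewrite sub0n add0n subn0.
- by rewrite addr_ge0// sumr_ge0.
rewrite big_ord_recl/= subn0 sub0n addn0 [X in 2 + X]big_ord_recr/=.
apply: (@le_trans _ _ (2^-1 ^+ n + (2 + \sum_(i < n) (2^-1 : R) ^+ i))); last by lra.
apply: lerD; last by apply: le_trans (IHn M); apply: ler_sum => t _; rewrite /bump/= !add1n !subSS.
by rewrite exprS ler_piMl//; lra.
Qed.

Section bmo_bound.
Variables (R : realType) (F : finFieldType) (dm k n N : nat).
Local Notation d := dm.+1.
Variable alpha : 'I_d * bool -> F.
Hypotheses (alpha_inj : injective alpha) (k_gt1 : (1 < k)%N) (card_F : #|F| = (2 ^ k)%N).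
Hypotheses (N_gt : ((2 ^ k) ^ n.-1 < N)%N) (N_le : (N <= (2 ^ k) ^ n)%N).
Hypotheses (d_le : (d <= k.*2)%N) (n_gt0 : (0 < n)%N).
Local Notation points := (points R n N alpha).
Local Notation q := #|F|.
Local Notation Q := (q%:R : R).
Implicit Types (j m : d.-tuple nat) (z : d.-tuple R).

Let Q_gt0 : 0 < Q. Proof. by rewrite ltr0n q_gt0. Qed.
Let QX_gt0 (e : nat) : 0 < Q ^+ e. Proof. exact: exprn_gt0. Qed.
Let two_gt0 (e : nat) : 0 < 2 ^+ e :> R. Proof. exact: exprn_gt0. Qed.
Let points_cube z : z \in points -> @unit_cube R d z.
Proof. by move=> zP; exact: (points_in_cube card_F N_gt N_le zP). Qed.

(** The constant of [low_error] times the loss [(Q ^+ 2) ^+ d] of [level_ge]. *)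
Let C2 : R := Q * (3 * (24 * Q ^+ 4) ^+ d + d%:R * 5 ^+ d) * (Q ^+ 2) ^+ d.
Let w j : R := (2 ^+ sumn j)^-1.
(* The weight of the boxes of level [t]: the squared bound on the error of the
   net for [t <= n], and on the volume term for [n < t]. *)
Let v (t : nat) : R := if (t <= n)%N then (C2 / 2 ^+ (n - t)) ^+ 2 else 2 * (Q ^+ n / Q ^+ t) ^+ 2.
Let c j m : R := \sum_(z <- points) (z \in @dyadic_box R d j m)%:R.

Let w_gt0 j : 0 < w j. Proof. by rewrite invr_gt0. Qed.
Let C2_ge0 : 0 <= C2.
Proof. by rewrite !mulr_ge0 ?addr_ge0 ?mulr_ge0 ?exprn_ge0 ?mulr_ge0 ?exprn_ge0// ltW. Qed.
Let v_ge0 t : 0 <= v t.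
Proof. by rewrite /v; case: ifP => _; rewrite ?mulr_ge0// sqr_ge0. Qed.

(** Up to level [n] this is the net error, with [Q ^- level k j] traded for [w j]. Beyond it the
    point sum and the volume are squared separately, and a box holds at most [2 ^ d] points, so
    [c j m ^+ 2 <= 2 ^+ d * c j m] makes the point part linear in the count. *)
Let coeff_bound j m : dyadic_index j m ->
  `|inner (discrepancy points) (haar j m)| ^+ 2 <=
  w j ^+ 2 * (v (level k j) + (n < level k j)%:R * (2 ^+ d.+1 * c j m)).
Proof.
move=> jm; rewrite inner_discrepancy// (card_points R alpha_inj k_gt1 card_F N_gt N_le).
rewrite normrM normrX normrN1 expr1n mul1r.
rewrite /v; have [le_n|lt_n] := leqP (level k j) n.
  rewrite mul0r addr0 -exprMn lerXn2r ?nnegrE ?mulr_ge0 ?divr_ge0 ?(ltW (w_gt0 _)) ?(ltW (two_gt0 _))//.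
  apply: le_trans (low_error R alpha_inj k_gt1 card_F N_gt N_le jm n_gt0 le_n) _.
  rewrite /C2; set C1 : R := Q * _.
  have C1_ge0 : 0 <= C1.
    by rewrite mulr_ge0 ?addr_ge0 ?mulr_ge0 ?exprn_ge0 ?mulr_ge0 ?exprn_ge0// ltW.
  have key : (Q ^+ level k j)^-1 <= (Q ^+ 2) ^+ d * w j.
    by rewrite /w ler_pdivlMr// mulrC ler_pdivrMr// mulrC; exact: level_ge.
  rewrite [leLHS](_ : _ = C1 * (Q ^+ level k j)^-1 / 2 ^+ (n - level k j)); last first.
    by rewrite invfM mulrA.
  rewrite [leRHS](_ : _ = C1 * ((Q ^+ 2) ^+ d * w j) / 2 ^+ (n - level k j)); last by ring.
  by rewrite ler_pM2r ?invr_gt0//; exact: ler_wpM2l.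
set S := \sum_(z <- _) _; set V := N%:R * _.
have S_ge0 : 0 <= S by apply: sumr_ge0 => z _; apply: prodr_ge0 => i _; exact: tent_ge0.
have V_ge0 : 0 <= V.
  by rewrite mulr_ge0//; apply: prodr_ge0 => i _; rewrite divr_ge0// sqr_ge0.
have S_le : S <= c j m * w j by exact: sum_points_tent_le.
have V_le : V <= Q ^+ n / Q ^+ level k j * w j.
  by exact: (high_volume_le R card_F N_le).
have c_le : c j m <= 2 ^+ d.
  rewrite /c -natr_sum -natrX ler_nat.
  exact: (sum_points_box R alpha_inj k_gt1 card_F N_gt N_le jm (ltnW lt_n)).
have c_ge0 : 0 <= c j m by apply: sumr_ge0.
rewrite mul1r real_normK ?num_real//.
apply: (@le_trans _ _ (2 * S ^+ 2 + 2 * V ^+ 2)).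
  have := sqr_ge0 (S + V); rewrite -subr_ge0; nra.
have S2 : S ^+ 2 <= w j ^+ 2 * (2 ^+ d * c j m).
  apply: (@le_trans _ _ ((c j m * w j) ^+ 2)); first by rewrite lerXn2r ?nnegrE// mulr_ge0// ltW.
  by rewrite exprMn mulrC ler_pM2l ?exprn_gt0// expr2 ler_wpM2r.
have V2 : V ^+ 2 <= w j ^+ 2 * (Q ^+ n / Q ^+ level k j) ^+ 2.
  rewrite -exprMn mulrC; rewrite lerXn2r ?nnegrE// ?mulr_ge0 ?divr_ge0// ltW//.
rewrite [2 ^+ d.+1]exprS [leRHS](_ : _ = 2 * (w j ^+ 2 * (2 ^+ d * c j m)) +
  2 * (w j ^+ 2 * (Q ^+ n / Q ^+ level k j) ^+ 2)); last by ring.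
by lra.
Qed.

(** The factor [t.+1 ^ dm] counts the vectors of level [t]. Below [n] it is at most [n.+1 ^ dm].
    Above, [t.+1 <= n.+1 * 2 ^ (t - n)], and the decay of [v] absorbs the powers of 2 because
    [d <= k.*2]. *)
Let v_weight t : v t * t.+1%:R ^+ dm <=
  (C2 ^+ 2 + 2) * n.+1%:R ^+ dm * 2^-1 ^+ ((n - t) + (t - n)).
Proof.
have half0 e : 0 <= (2^-1 : R) ^+ e by rewrite exprn_ge0 ?invr_ge0.
rewrite /v; have [le_t|lt_t] := leqP t n.
  rewrite (eqP le_t) addn0 [leRHS]mulrAC; apply: ler_pM; rewrite ?sqr_ge0 ?exprn_ge0//.
    rewrite expr_div_n exprVn; apply: ler_pM; rewrite ?sqr_ge0 ?invr_ge0 ?sqr_ge0//.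
      by rewrite lerDl.
    by rewrite lef_pV2 ?posrE ?exprn_gt0// ler_eXnr// exprn_ege1// ler1n.
  by rewrite lerXn2r ?nnegrE// ler_nat.
set s := (t - n)%N; have -> : (n - t = 0)%N by apply/eqP; exact: ltnW.
have E : Q ^+ n / Q ^+ t = (Q ^+ s)^-1.
  by rewrite -(subnKC (ltnW lt_t)) exprD invfM mulrA divff ?mul1r// gt_eqF.
have ts : t.+1%:R <= n.+1%:R * 2 ^+ s :> R.
  rewrite -natrX -natrM ler_nat; apply: (@leq_trans (n.+1 * s.+1)%N); first by rewrite /s; nia.
  by rewrite leq_mul2l /=; exact: ltn_expl.
have Qs : 2 ^+ s ^+ dm * 2 ^+ s <= Q ^+ s ^+ 2.
  rewrite -exprSr -!exprM (card_F_natr R card_F) -!exprM ler_weXn2l ?ler1n//.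
  rewrite mulnCA leq_mul2l; apply/orP; right.
  by move: d_le; rewrite -muln2.
rewrite E add0n; apply: (@le_trans _ _ (2 * (Q ^+ s)^-1 ^+ 2 * (n.+1%:R * 2 ^+ s) ^+ dm)).
  by rewrite ler_wpM2l ?mulr_ge0 ?sqr_ge0// lerXn2r ?nnegrE ?mulr_ge0// ltW.
rewrite exprMn exprVn exprVn.
have h : 2 ^+ s ^+ dm / Q ^+ s ^+ 2 <= (2 ^+ s)^-1.
  by rewrite ler_pdivrMr ?exprn_gt0// mulrC ler_pdivlMr.
rewrite [leLHS](_ : _ = 2 * n.+1%:R ^+ dm * (2 ^+ s ^+ dm / Q ^+ s ^+ 2)); last by ring.
apply: ler_pM => //; rewrite ?mulr_ge0 ?divr_ge0 ?exprn_ge0//.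
by rewrite ler_wpM2r ?exprn_ge0// lerDr sqr_ge0.
Qed.

Let C3 : R := (C2 ^+ 2 + 2) * (k.*2)%:R ^+ d * 4.

Let sum_v (X : seq (d.-tuple nat)) : uniq X ->
  \sum_(j <- X) v (level k j) <= C3 * n.+1%:R ^+ dm.
Proof.
move=> uX; pose M := (\max_(j <- X) level k j).+1.
have lM j : j \in X -> (level k j < M)%N.
  by move=> jX; rewrite ltnS; exact: leq_bigmax_seq.
have -> : \sum_(j <- X) v (level k j) =
    \sum_(t < M) v t * (size [seq j <- X | level k j == t])%:R.
  rewrite (eq_big_seq (fun j => \sum_(t < M) v t * (level k j == t)%:R)).
    rewrite exchange_big/=; apply: eq_bigr => t _; rewrite -mulr_sumr; congr (_ * _).
    by rewrite size_filter -sum1_count natr_sum [RHS]big_mkcond; apply: eq_bigr => j _ /=; case: ifP.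
  move=> j /lM lj; rewrite (bigD1 (Ordinal lj))//= eqxx mulr1 big1 ?addr0// => t.
  by rewrite -val_eqE/= eq_sym => /negbTE->; rewrite mulr0.
apply: (@le_trans _ _ (\sum_(t < M) (C2 ^+ 2 + 2) * (k.*2)%:R ^+ d * n.+1%:R ^+ dm *
    2^-1 ^+ ((n - t) + (t - n)))).
  apply: ler_sum => t _.
  apply: (@le_trans _ _ (v t * ((k.*2)%:R ^+ d * t.+1%:R ^+ dm))).
    rewrite ler_wpM2l// -!natrX -natrM ler_nat.
    apply: count_level; rewrite ?filter_uniq ?(ltnW k_gt1)// => j.
    by rewrite mem_filter => /andP[/eqP].
  rewrite mulrCA [leRHS](_ : _ = (k.*2)%:R ^+ d * ((C2 ^+ 2 + 2) * n.+1%:R ^+ dm *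
    2^-1 ^+ ((n - t) + (t - n)))); last by ring.
  by rewrite ler_wpM2l ?exprn_ge0.
rewrite -mulr_sumr /C3 [leRHS](_ : _ = (C2 ^+ 2 + 2) * (k.*2)%:R ^+ d * n.+1%:R ^+ dm * 4); last by ring.
by rewrite ler_wpM2l ?sum_pow_dist// !mulr_ge0 ?exprn_ge0// addr_ge0 ?sqr_ge0.
Qed.

Let sum_box_cell j (Y : seq (d.-tuple nat)) x : uniq Y -> unit_cube x ->
  (\sum_(m <- Y) (x \in @dyadic_box R d j m) = (cell j x \in Y))%N.
Proof.
move=> uY xC; rewrite -count_uniq_mem// -sum1_count [RHS]big_mkcond.
apply: eq_bigr => m _ /=; rewrite eq_sym; case: eqP => [|ne].
  by move=> /dyadic_boxP -/(_ xC) h2; rewrite mem_set.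
by rewrite memNset// => /dyadic_boxP -/(_ xC).
Qed.

(** The factor [2 ^+ d.+1] comes from [coeff_bound], one [2 ^+ d] from passing to twins, the other
    from [overlap_le]. Neither [n] nor [N] enters. *)
Definition bmo_const : R := C3 + 2 ^+ d.+1 * 2 ^+ d * 2 ^+ d.

Lemma bmo_const_ge0 : 0 <= bmo_const.
Proof.
have C3_ge0 : 0 <= C3.
  by apply: mulr_ge0 => //; apply: mulr_ge0; rewrite ?exprn_ge0// addr_ge0 ?sqr_ge0.
have P0 : 0 < 2 ^+ d.+1 * 2 ^+ d * 2 ^+ d :> R by do 2 apply: mulr_gt0 => //.
by rewrite /bmo_const addr_ge0// ltW.
Qed.

(** * The BMO sum over a fixed set *)

Section fixed_set.
Variable U : set (d.-tuple R).
Hypotheses (mU : lebesgue_measurable U) (U_cube : U `<=` unit_cube).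
Local Notation mu := (lebesgue_tuple R d).

Let box_measurable j m : lebesgue_measurable (@dyadic_box R d j m).
Proof. by apply: borel_lebesgue_measurable; exact: dyadic_box_measurable. Qed.

Let unit_cubeE : unit_cube = @dyadic_box R d [tuple of nseq d 0%N] [tuple of nseq d 0%N].
Proof.
apply/seteqP; split => x xC i; have := xC i;
by rewrite /Defs.dyadic_itv/= !tnth_nseq !in_itv/= expr0 !divr1.
Qed.

Let lebesgue_tuple_cube : mu unit_cube = 1%E.
Proof.
by rewrite unit_cubeE dyadic_box_measure sumn_nseq mul0n expr0 invr1.
Qed.

Let muU_fin : mu U \is a fin_num.
Proof.
rewrite ge0_fin_numE; last exact: measure_ge0.
apply: (@le_lt_trans _ _ (1%E : \bar R)); last exact: ltry.
rewrite -lebesgue_tuple_cube; apply: le_measure => //; rewrite inE//.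
rewrite unit_cubeE; exact: box_measurable.
Qed.

Let M := fine (mu U).
Let muE : mu U = M%:E. Proof. by rewrite fineK. Qed.

(** Boxes of the same level are disjoint, so they cover [U] with multiplicity at most 1. *)
Let boxes_le j (Y : seq (d.-tuple nat)) : uniq Y ->
  (forall m, m \in Y -> dyadic_index j m /\ (@dyadic_box R d j m `<=` U)%classic) ->
  w j * (size Y)%:R <= M.
Proof.
move=> uY YU; rewrite -lee_fin -muE -[mu U]mul1e.
have := @measure_overlap R _ _ mu U _ Y (fun m => @dyadic_box R d j m) (mem Y) 1 mU.
rewrite -big_seq (eq_bigr (fun=> (w j)%:E)); last by move=> m _; exact: dyadic_box_measure.
rewrite sumEFin big_const_seq count_predT iter_addr_0 => h; rewrite mulr_natr; apply: h.
- by move=> m; exact: box_measurable.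
- by move=> m /YU[].
- move=> x /U_cube xC; rewrite -big_seq -natr_sum lern1.
  by rewrite sum_box_cell//; case: (_ \in _).
Qed.

(* [inside j z] selects the boxes of level [j] that contribute to the counting
   part below the scale of the net. *)
Let inside j z : bool := (n < level k j)%N && `[< (dyadic_box j (cell j z) `<=` U)%classic >].
Let W j : R := \sum_(z <- points) (inside j z)%:R * (2 ^+ d.+1 * w j).

(** The factor [2 ^+ sumn j] cancels one of the two factors [w j]. In the first part the other one,
    times the number of boxes, is at most [M]; in the point part each point lies in only one box of
    level [j]. *)
Let per_level j :
  ((2 ^+ sumn j)%:E * (\esum_(m in [set m | dyadic_index j m /\ (@dyadic_box R d j m `<=` U)%classic])
     (`|inner (discrepancy points) (haar j m)| ^+ 2)%:E) <= (v (level k j) * M + W j)%:E)%E.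
Proof.
have -> : v (level k j) * M + W j = 2 ^+ sumn j * (w j * (v (level k j) * M + W j)).
  by rewrite mulrA /w divff ?mul1r// gt_eqF.
rewrite EFinM; apply: lee_wpmul2l; first by rewrite lee_fin ltW.
apply: esum_le_seq => Y uY YS.
apply: (@le_trans _ _ (\sum_(m <- Y) w j ^+ 2 * (v (level k j) + (n < level k j)%:R * (2 ^+ d.+1 * c j m)))).
  by rewrite big_seq [leRHS]big_seq; apply: ler_sum => m /YS[? _]; exact: coeff_bound.
rewrite -mulr_sumr expr2 -mulrA ler_wpM2l ?(ltW (w_gt0 _))// big_split/= mulrDr; apply: lerD.
  rewrite big_const_seq count_predT iter_addr_0 -mulr_natr mulrCA ler_wpM2l//.
  exact: boxes_le.
rewrite /W -mulr_suml.
rewrite [leLHS](_ : _ = ((n < level k j)%:R * \sum_(m <- Y) c j m) * (2 ^+ d.+1 * w j)); last first.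
  by rewrite -!mulr_sumr; ring.
apply: ler_wpM2r; first by rewrite mulr_ge0 ?(ltW (two_gt0 _)) ?(ltW (w_gt0 _)).
rewrite /c exchange_big/= mulr_sumr big_seq [leRHS]big_seq; apply: ler_sum => z /points_cube zC.
rewrite -natr_sum sum_box_cell// /inside; case: (_ < _)%N; last by rewrite mul0r.
rewrite mul1r ler_nat; case: (boolP (cell j z \in Y)) => // /YS[_ h].
by rewrite asboolT.
Qed.

(** [w j / 2 ^+ d] is the measure of the twin, which stays inside the box and hence inside [U];
    [overlap_le] bounds how often the twins cover a point. *)
Let sum_W (X : seq (d.-tuple nat)) : uniq X ->
  \sum_(j <- X) W j <= 2 ^+ d.+1 * 2 ^+ d * (2 ^ d * (uphalf n).+1 ^ dm)%N%:R * M.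
Proof.
move=> uX.
pose pairs := [seq (j, z) | j <- X, z <- points].
pose P (p : d.-tuple nat * d.-tuple R) := (p.2 \in points) && inside p.1 p.2.
have -> : \sum_(j <- X) W j = 2 ^+ d.+1 * 2 ^+ d * \sum_(p <- pairs | P p) w p.1 / 2 ^+ d.
  rewrite [X in _ = _ * X]big_mkcond /pairs big_allpairs/= mulr_sumr; apply: eq_bigr => j _.
  rewrite mulr_sumr /W big_seq [RHS]big_seq; apply: eq_bigr => z zP.
  rewrite /P/= zP; case: (inside j z); rewrite ?mul0r ?mulr0// mul1r.
  by rewrite -[RHS]mulrA; congr (_ * _); rewrite mulrCA divff ?mulr1// gt_eqF.
rewrite -[leRHS]mulrA; apply: ler_wpM2l; first by rewrite mulr_ge0 ?(ltW (two_gt0 _)).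
rewrite -lee_fin -sumEFin EFinM -muE.
rewrite (eq_bigr (fun p => mu (twin p.1 p.2))); last first.
  by move=> p _; rewrite dyadic_box_measure sumn_refine exprD invfM.
apply: measure_overlap => //.
- by move=> p; exact: box_measurable.
- move=> p /andP[/points_cube pC /andP[_ /asboolP h]].
  by apply: subset_trans h; exact: twin_sub.
move=> x /U_cube xC.
have := overlap_le alpha_inj k_gt1 card_F N_gt N_le uX xC.
rewrite -(ler_nat R); apply: le_trans.
rewrite natr_sum [leLHS]big_mkcond /pairs big_allpairs [leRHS]big_mkcond/=; apply: ler_sum => j _.
case: ifPn => nj; last first.
  by rewrite big1// => z _; rewrite /P /inside/= (negbTE nj) andbF.
by rewrite natr_sum; apply: ler_sum => z _; case: ifP.
Qed.

Lemma bmo_sum_le : (bmo_sum (discrepancy points) U <=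
  (bmo_const * n.+1%:R ^+ dm)%:E * mu U)%E.
Proof.
rewrite muE -EFinM; have M_ge0 : 0 <= M by apply: fine_ge0; exact: measure_ge0.
rewrite /bmo_sum; apply: le_trans.
  by apply: le_esum => j _; exact: per_level.
apply: esum_le_seq => X uX _; rewrite big_split/= -mulr_suml /bmo_const !mulrDl; apply: lerD.
  by rewrite ler_wpM2r// sum_v.
apply: le_trans (sum_W uX) _; rewrite ler_wpM2r// -[leRHS]mulrA.
apply: ler_wpM2l; first by rewrite mulr_ge0 ?(ltW (two_gt0 _)).
rewrite natrM !natrX; apply: ler_wpM2l; first exact: ltW.
by rewrite lerXn2r ?nnegrE// ler_nat ltnS leq_uphalf_double -addnn leq_addr.
Qed.

Lemma bmo_average_le : (0 < mu U)%E ->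
  (sqrte ((mu U)^-1 * bmo_sum (discrepancy points) U) <=
   (Num.sqrt (bmo_const * n.+1%:R ^+ dm))%:E)%E.
Proof.
rewrite muE lte_fin => M0; have := bmo_sum_le; rewrite muE -EFinM => h.
rewrite -[leRHS]/(sqrte (bmo_const * n.+1%:R ^+ dm)%:E) lee_sqrt; last first.
  by rewrite lee_fin mulr_ge0 ?bmo_const_ge0// exprn_ge0.
rewrite inver gt_eqF//; apply: (@le_trans _ _ (M^-1%:E * (bmo_const * n.+1%:R ^+ dm * M)%:E)%E).
  by apply: lee_wpmul2l => //; rewrite lee_fin invr_ge0 ltW.
by rewrite -EFinM lee_fin mulrC mulfK// gt_eqF.
Qed.

End fixed_set.

Lemma bmo_norm_le :
  (bmo_norm (discrepancy points) <= (Num.sqrt (bmo_const * n.+1%:R ^+ dm))%:E)%E.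
Proof. by apply: ub_ereal_sup => _ [U [mU U_cube U0] <-]; exact: bmo_average_le. Qed.

End bmo_bound.

(** * Choice of the parameters and conclusion *)

Lemma exists_injection (A B : finType) : (#|A| <= #|B|)%N -> exists f : A -> B, injective f.
Proof.
move=> AB; exists (fun a => enum_val (widen_ord AB (enum_rank a))).
by move=> a b /enum_val_inj/(congr1 val)/= /val_inj/enum_rank_inj.
Qed.

(** By minimality [(2 ^ k) ^ n.-1 < N], so [n.-1 * ln 2 <= ln N]. The remaining [2 * ln 2] is at
    most [2 * ln N], which gives the 3. *)
Lemma up_log_le_ln (R : realType) (k N : nat) : (1 < k)%N -> (1 < N)%N ->
  (up_log (2 ^ k) N).+1%:R <= 3 / ln 2 * ln N%:R :> R.
Proof.
move=> k1 N1; set n := up_log _ _.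
have p1 : (1 < 2 ^ k)%N by rewrite (ltn_trans k1)// ltn_expl.
have /andP[N_gt _] := up_log_bounds p1 N1; rewrite -/n in N_gt.
have ln2 : 0 < ln 2 :> R by rewrite ln_gt0// ltr1n.
have l1 : ln 2 <= ln N%:R :> R.
  by rewrite ler_ln ?posrE ?ltr0n// ?ler_nat// ltnW.
have l2 : n.-1%:R * ln 2 <= ln N%:R :> R.
  rewrite mulr_natl -lnXn//; rewrite ler_ln ?posrE ?exprn_gt0 ?ltr0n//; last exact: ltnW.
  rewrite -natrX ler_nat; apply: leq_trans (ltnW N_gt); rewrite -expnM.
  by rewrite leq_pexp2l// leq_pmull// ltnW.
rewrite mulrAC ler_pdivlMr//; apply: (@le_trans _ _ ((n.-1%:R + 2) * ln 2)); last by lra.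
rewrite ler_pM2r// -natrD ler_nat; lia.
Qed.

Theorem theorem1p1 (R : realType) (d : nat) (hd : (3 <= d)%N) :
  exists C : R, 0 < C /\
    forall N : nat, (2 <= N)%N ->
      exists P : {fset d.-tuple R},
        [/\ #|` P| = N,
            (forall z, z \in P -> unit_cube z)
          & (bmo_norm (discrepancy P)
               <= (C * (ln N%:R) `^ ((d%:R - 1) / 2))%:E)%E].
Proof.
have k_gt0 : (0 < d)%N by exact: leq_trans hd.
have k_gt1 : (1 < d)%N by exact: leq_trans hd.
(* Here [k = d]: then [2 ^ d] is at least [2d], enough distinct elements for [alpha], and
   [d <= k.*2] holds. *)
have [F _ card_F] := finfield.pPrimePowerField (isT : prime 2) k_gt0.
have cI : (#|{: 'I_d * bool}| <= #|F|)%N.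
  rewrite card_prod card_ord card_bool card_F muln2.
  by rewrite -[d]prednK// expnS mul2n leq_double ltn_expl.
have [alpha alpha_inj] := exists_injection cI.
case: d hd k_gt0 k_gt1 card_F alpha alpha_inj {cI} => // dm hd k_gt0 k_gt1 card_F alpha alpha_inj.
pose K := bmo_const R F dm dm.+1; pose a : R := 3 / ln 2.
have K0 : 0 <= K := bmo_const_ge0 R F dm dm.+1.
have ln2 : 0 < ln 2 :> R by rewrite ln_gt0// ltr1n.
have a0 : 0 <= a by rewrite divr_ge0// ltW.
(* [K] and [a] are only shown to be nonnegative; the added 1 makes the constant positive. *)
exists (Num.sqrt (K * a ^+ dm) + 1); split; first by rewrite ltr_wpDl// sqrtr_ge0.
move=> N N2; pose n := up_log (2 ^ dm.+1) N.
have p1 : (1 < 2 ^ dm.+1)%N by rewrite (ltn_trans k_gt1)// ltn_expl.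
have /andP[N_gt N_le] := up_log_bounds p1 N2.
have n_gt0 : (0 < n)%N by rewrite up_log_gt0 p1.
have d_le : (dm.+1 <= dm.+1.*2)%N by rewrite -addnn leq_addr.
exists (points R n N alpha); split.
- exact: (card_points R alpha_inj k_gt1 card_F N_gt N_le).
- by move=> z zP; exact: (points_in_cube card_F N_gt N_le zP).
apply: le_trans (bmo_norm_le R alpha_inj k_gt1 card_F N_gt N_le d_le n_gt0) _.
have lnN : 0 <= ln N%:R :> R by rewrite ln_ge0// ler1n ltnW.
have -> : ln N%:R `^ ((dm.+1%:R - 1) / 2) = Num.sqrt (ln N%:R ^+ dm) :> R.
  by rewrite -natr1 addrK powRrM powR12_sqrt ?powR_ge0// powR_mulrn.
rewrite lee_fin; apply: (@le_trans _ _ (Num.sqrt (K * a ^+ dm) * Num.sqrt (ln N%:R ^+ dm))).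
  rewrite -sqrtrM ?mulr_ge0 ?exprn_ge0//; apply: ler_wsqrtr.
  rewrite -/K -mulrA -exprMn; apply: ler_wpM2l => //.
  apply: lerXn2r; rewrite ?nnegrE//; first exact: mulr_ge0.
  exact: up_log_le_ln.
by rewrite ler_wpM2r ?sqrtr_ge0// lerDl.
Qed.
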